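(* Let $(A,\phi_0,P,N)$ be a Jacobi-Nijenhuis algebroid over $M$ (with $A$ and $M$ orientable), with $N$ a non-degenerate Nijenhuis operator compatible with $P$. Then the modular vector field $X_{(N,P)}$ is a $\mathrm d_{NP}$-coboundary and determines a hierarchy of ($A$-)vector fields $$X_{(N,P)}^{i+j}=N^{i+j-1}X_{(N,P)}=\mathrm d_{N^iP}h_j=\mathrm d_{N^jP}h_i\qquad(i,j\in\mathbb Z),$$ where $$h_0=\ln(\det N)\qquad\text{and}\qquad h_i=\frac1i\operatorname{Tr}N^i\quad(i\ne0).$$ This hierarchy covers a hierarchy of vector fields on $M$ given by $$X_M^{i+j}=-(N^iP)_M^\sharp(dh_j)=-(N^jP)_M^\sharp(dh_i),$$ and defines a hierarchy of vector fields on the Lie algebroid $TM\times\mathbb R$ (that is, sections of it) given by $$Y^{i+j}=X_M^{i+j}+\langle dh_j,E_M^i\rangle\frac{\partial}{\partial t},$$ where $((N^iP)_M,E_M^i)$ are the Jacobi structures on $M$ induced by the Jacobi bivectors $N^iP$ on $A$.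
   Context: A Jacobi algebroid $(A,\phi_0)$ is a Lie algebroid $(A,[\cdot,\cdot],\rho)$ over $M$ with a 1-cocycle $\phi_0\in\Gamma(A^* )$ ($\mathrm d\phi_0=0$, $\mathrm d$ the Lie algebroid differential; $d$ denotes the de Rham differential). The Schouten bracket on $\Gamma(\wedge^\bullet A)$ extends the Lie bracket with $[X,f]=\rho(X)f$, $[P,Q]=-(-1)^{(p-1)(q-1)}[Q,P]$, $[P,Q\wedge R]=[P,Q]\wedge R+(-1)^{(p-1)q}Q\wedge[P,R]$. The Schouten-Jacobi bracket is $[P,Q]^{\phi_0}=[P,Q]+(p-1)P\wedge i_{\phi_0}Q-(-1)^{p-1}(q-1)\,i_{\phi_0}P\wedge Q$. For a bivector $P$, $\langle\beta,P^\sharp\alpha\rangle=P(\alpha,\beta)$. A Jacobi bivector is $P\in\Gamma(\wedge^2A)$ with $[P,P]^{\phi_0}=0$. With $\mathrm d^{\phi_0}\omega=\mathrm d\omega+\phi_0\wedge\omega$ and $\mathcal L^{\phi_0}_X=i_X\mathrm d^{\phi_0}+\mathrm d^{\phi_0}i_X$ for $X\in\Gamma(A)$, a bivector $Q$ on $(A,\phi_0)$ defines on $\Gamma(A^* )$ the bracket $[\alpha,\beta]_Q=\mathcal L^{\phi_0}_{Q^\sharp\alpha}\beta-\mathcal L^{\phi_0}_{Q^\sharp\beta}\alpha-\mathrm d^{\phi_0}(Q(\alpha,\beta))$. If $Q$ is a Jacobi bivector, this with anchor $\rho\circ Q^\sharp$ is a Lie algebroid structure $A^*_Q$ on $A^*$,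 whose differential on $\Gamma(\wedge^\bullet A)$ is denoted $\mathrm d_Q$; on functions $\mathrm d_Qf=-Q^\sharp(\mathrm df)$. The Jacobi structure on $M$ induced by $Q$ is $(Q_M,E_M)$, with $Q_M(\alpha,\beta)=Q(\rho^*\alpha,\rho^*\beta)$ for $\alpha,\beta\in\Omega^1(M)$ and $E_M=\rho(Q^\sharp(\phi_0))$; for $Q=N^iP$ it is denoted $((N^iP)_M,E_M^i)$. (A Jacobi structure $(\Lambda,E)$ on $M$ satisfies $[\Lambda,\Lambda]=-2E\wedge\Lambda$, $[E,\Lambda]=0$.) A Nijenhuis operator on a Lie algebroid $(B,[\cdot,\cdot],\rho_B)$ is a bundle map $N:B\to B$ over the identity with $[NX,NY]=N[X,Y]_N$, where $[X,Y]_N=[NX,Y]+[X,NY]-N[X,Y]$; then $B_N=(B,[\cdot,\cdot]_N,\rho_B\circ N)$ is a Lie algebroid. For $B=A$, $N^*\phi_0$ is a 1-cocycle of $A_N$. Non-degenerate means invertible. A Jacobi-Nijenhuis algebroid $(A,\phi_0,P,N)$ is a Jacobi algebroid with a Jacobi bivector $P$ and a Nijenhuis operator $N$ that are compatible: (1) $N\circ P^\sharp=P^\sharp\circ N^*$ (so $NP$, with $(NP)^\sharp=N\circ P^\sharp$, is a bivector); (2) the bracket $[\cdot,\cdot]_{NP}$ defined by $NP$ on $(A,\phi_0)$ equals the bracket on $\Gamma(A^* )$ defined by $P$ on the Jacobi algebroid $(A_N,N^*\phi_0)$. $N^iP$ is the bivector with $(N^iP)^\sharp=N^i\circ P^\sharp$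 ($i\in\mathbb Z$ when $N$ is invertible). Write $A^*=A^*_P$; $N^*$ is a Nijenhuis operator on $A^*$ and the deformed Lie algebroid $A^*_{N^*}$ equals $A^*_{NP}$. For a Lie algebroid $(B,[\cdot,\cdot],\rho_B)$ over $M$ and non-vanishing $\eta\in\Gamma(\wedge^{\mathrm{top}}B)$, $\mu\in\Omega^{\mathrm{top}}(M)$, the modular form $\xi_B^{\eta\otimes\mu}\in\Gamma(B^* )$ is defined by $\langle\xi_B^{\eta\otimes\mu},X\rangle\,\eta\otimes\mu=[X,\eta]\otimes\mu+\eta\otimes\mathcal L_{\rho_B(X)}\mu$. The modular vector field of $(A,\phi_0,P,N)$ is $X_{(N,P)}=\xi_{A^*_{N^*}}^{\nu\otimes\mu}-N\,\xi_{A^*}^{\nu\otimes\mu}\in\Gamma(A)$, for non-vanishing $\nu\in\Gamma(\wedge^{\mathrm{top}}A^* )$ and a volume form $\mu$ on $M$; it does not depend on the choice of $\nu\otimes\mu$. An $A$-vector field is a section of $A$; it covers the vector field on $M$ that is its image under the anchor $\rho$. Sections of the Lie algebroid $TM\times\mathbb R\to M$ (bracket $[(X,f),(Y,g)]=([X,Y],X(g)-Y(f))$, anchor $(X,f)\mapsto X$) are written $X+f\frac{\partial}{\partial t}$.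
   Formalization: The function h_0 = ln(det N) is taken as ln|det N|, since a non-degenerate N may have negative determinant (e.g. N = -Id in odd rank), where ln(det N) is undefined; the two agree wherever det N > 0. *)

(* Defs.v *)
From HB Require Import structures.
From mathcomp Require Import all_boot all_order all_algebra all_fingroup.
From mathcomp Require Import all_classical all_reals all_analysis.

Set Implicit Arguments.
Unset Strict Implicit.
Unset Printing Implicit Defensive.

Import Order.TTheory GRing.Theory Num.Theory numFieldNormedType.Exports.

Local Open Scope classical_set_scope.
Local Open Scope ring_scope.

Section Smoothness.
Context {R : realType}.

Fixpoint diffn {m : nat} (n : nat) (f : 'cV[R]_m -> R) (p : 'cV[R]_m) : Prop :=
  if n is n'.+1 then
    (\forall q \near p, differentiable f q) /\
    (forall v, diffn n' (fun q => 'D_v f q) p)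
  else True.

(* Infinitely differentiable: [diffn n f p] says that all iterated directional
   derivatives of order < n are Frechet differentiable near p. *)
Definition smooth_at {m : nat} (f : 'cV[R]_m -> R) (p : 'cV[R]_m) : Prop :=
  forall n, diffn n f p.

Definition jac {m k : nat} (g : 'cV[R]_m -> 'cV[R]_k) (p : 'cV[R]_m) :
    'M[R]_(k, m) :=
  \matrix_(i, j) 'D_(delta_mx j 0) (fun q => g q i 0) p.

Lemma near_eq_differentiable {m : nat} (f g : 'cV[R]_m -> R) p :
  (\forall q \near p, f q = g q) -> differentiable f p -> differentiable g p.
Proof.
move=> fg df; have dfc := diff_continuous df.
have fgp : f p = g p by exact: nbhs_singleton fg.
have E : g \o shift p = cst (g p) + 'd f p +o_ 0 id.
  apply/eqaddoP => e e0.
  have /eqaddoP/(_ e e0) H := diff_locally df.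
  have : \forall h \near (0 : 'cV[R]_m), f (h + p) = g (h + p).
    move: fg; rewrite (near_shift 0) /= => fg0.
    by apply: filterS fg0 => h /=; rewrite subr0.
  move=> fg0; near=> h.
  have : (g \o shift p - (cst (g p) + 'd f p)) h =
         (f \o shift p - (cst (f p) + 'd f p)) h.
    rewrite !fctE /= fgp; congr (_ - _); apply/esym; near: h; exact: fg0.
  move=> ->; near: h; exact: H.
apply/diff_locallyP; rewrite (diff_unique dfc E); split => //.
Unshelve. all: by end_near. Qed.

Lemma diffnW {m : nat} n (f : 'cV[R]_m -> R) p : diffn n.+1 f p -> diffn n f p.
Proof.
elim: n f p => [//|n IH] f p [df dvf]; split => // v.
exact/IH/dvf.
Qed.

Lemma near_eq_diffn {m : nat} n (f g : 'cV[R]_m -> R) p :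
  (\forall q \near p, f q = g q) -> diffn n f p -> diffn n g p.
Proof.
elim: n f g p => [//|n IH] f g p fg [df dvf].
have fg2 := near_join fg.
split.
  near=> q; apply: (@near_eq_differentiable _ f); last by near: q; exact: df.
  by near: q; exact: fg2.
move=> v; apply: (IH (fun q => 'D_v f q)); last exact: dvf.
near=> q; apply: near_eq_derive; near: q; exact: fg2.
Unshelve. all: by end_near. Qed.

Lemma diffnD {m : nat} n (f g : 'cV[R]_m -> R) p :
  diffn n f p -> diffn n g p -> diffn n (fun q => f q + g q) p.
Proof.
elim: n f g p => [//|n IH] f g p [df dvf] [dg dvg]; split.
  by near=> q; apply: differentiableD; near: q.
move=> v; apply: near_eq_diffn (IH _ _ _ (dvf v) (dvg v)).
near=> q; rewrite deriveD //; apply: diff_derivable; near: q; [exact: df|exact: dg].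
Unshelve. all: by end_near. Qed.

Lemma diffnM {m : nat} n (f g : 'cV[R]_m -> R) p :
  diffn n f p -> diffn n g p -> diffn n (fun q => f q * g q) p.
Proof.
elim: n f g p => [//|n IH] f g p Df Dg.
have [[df dvf] [dg dvg]] := (Df, Dg); split.
  by near=> q; apply: differentiableM; near: q.
move=> v; apply: near_eq_diffn (diffnD (IH _ _ _ (diffnW Df) (dvg v))
                                       (IH _ _ _ (diffnW Dg) (dvf v))).
near=> q; rewrite deriveM //; apply: diff_derivable; near: q; [exact: df|exact: dg].
Unshelve. all: by end_near. Qed.

Lemma diffn_cst {m : nat} n (c : R) (p : 'cV[R]_m) : diffn n (fun=> c) p.
Proof.
elim: n c p => [//|n IH] c p; split; first by near=> q; exact: differentiable_cst.
move=> v; apply: near_eq_diffn (IH 0 p); near=> q.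
by rewrite [RHS](derive_cst c q v).
Unshelve. all: by end_near. Qed.

Lemma diffn_sum {m k : nat} n (f : 'I_k -> 'cV[R]_m -> R) p :
  (forall i, diffn n (f i) p) -> diffn n (fun q => \sum_i f i q) p.
Proof.
move=> df; suff H (s : seq 'I_k) : diffn n (fun q => \sum_(i <- s) f i q) p by [].
elim: s => [|i s IH].
  by under eq_fun do rewrite big_nil; exact: diffn_cst.
by under eq_fun do rewrite big_cons; exact: diffnD.
Qed.

Lemma differentiable_col {m k : nat} (g : 'cV[R]_m -> 'cV[R]_k) p :
  (forall i, differentiable (fun q => g q i 0) p) -> differentiable g p.
Proof.
move=> dg; have -> : g = \sum_i (fun q => g q i 0 *: delta_mx i 0).
  apply/funext => q; rewrite fct_sumE; apply/matrixP => i j; rewrite ord1 summxE.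
  rewrite (bigD1 i) //= big1 ?addr0 ?mxE ?eqxx ?mulr1 // => l li.
  by rewrite !mxE eq_sym (negbTE li) mulr0.
by apply: differentiable_sum => i; exact: differentiableZl.
Qed.

Lemma derive_jac {m : nat} (f : 'cV[R]_m -> R) p v :
  differentiable f p ->
  'D_v f p = \sum_i v i 0 * 'D_(delta_mx i 0) f p.
Proof.
move=> df; rewrite deriveE // [in LHS](matrix_sum_delta v) linear_sum.
apply: eq_bigr => i _; rewrite big_ord_recl big_ord0 addr0 linearZ.
by rewrite -deriveE // (_ : lift _ _ = 0) // ord1.
Qed.

Lemma derive_comp_col {m k : nat} (f : 'cV[R]_k -> R) (g : 'cV[R]_m -> 'cV[R]_k)
    p v :
  differentiable f (g p) -> (forall i, differentiable (fun q => g q i 0) p) ->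
  'D_v (fun q => f (g q)) p =
  \sum_i 'D_v (fun q => g q i 0) p * 'D_(delta_mx i 0) f (g p).
Proof.
move=> df dg; have dg' := differentiable_col dg.
rewrite -[fun q => f (g q)]/(f \o g) deriveE; last exact: differentiable_comp.
rewrite diff_comp //= -deriveE // -[X in 'D_(X) f _]deriveE // derive_jac //.
by apply: eq_bigr => i _; rewrite derive_mx ?mxE //; exact: diff_derivable.
Qed.

Lemma diffn_comp {m k : nat} n (f : 'cV[R]_k -> R) (g : 'cV[R]_m -> 'cV[R]_k) p :
  diffn n f (g p) -> (forall i, diffn n (fun q => g q i 0) p) ->
  diffn n (fun q => f (g q)) p.
Proof.
elim: n f => [//|n IH] f Df Dg.
have dg1 i : \forall q \near p, differentiable (fun q => g q i 0) q.
  by case: (Dg i).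
have dg : \forall q \near p, forall i, differentiable (fun q => g q i 0) q.
  exact: filter_forall dg1.
have cg : {for p, continuous g}.
  apply: differentiable_continuous; apply: differentiable_col => i.
  exact: nbhs_singleton (proj1 (Dg i)).
have df : \forall q \near p, differentiable f (g q) by exact: cg (proj1 Df).
split.
  near=> q; rewrite -[fun q => f (g q)]/(f \o g).
  apply: differentiable_comp; last by near: q.
  by apply: differentiable_col; near: q; exact: dg.
move=> v.
have : diffn n (fun q => \sum_i 'D_v (fun q => g q i 0) q *
                               'D_(delta_mx i 0) f (g q)) p.
  apply: diffn_sum => i; apply: diffnM; first exact: (proj2 (Dg i)).
  by apply: (IH ('D_(delta_mx i 0) f)) => [|j]; [exact: (proj2 Df)|exact/diffnW/Dg].
apply: near_eq_diffn; near=> q; apply/esym/derive_comp_col; near: q.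
  exact: df.
exact: dg.
Unshelve. all: by end_near. Qed.

Lemma smooth_at_near_eq {m : nat} (f g : 'cV[R]_m -> R) p :
  (\forall q \near p, f q = g q) -> smooth_at f p -> smooth_at g p.
Proof. by move=> fg sf n; exact: near_eq_diffn fg (sf n). Qed.

Lemma smooth_at_comp {m k : nat} (f : 'cV[R]_k -> R) (g : 'cV[R]_m -> 'cV[R]_k) p :
  smooth_at f (g p) -> (forall i, smooth_at (fun q => g q i 0) p) ->
  smooth_at (fun q => f (g q)) p.
Proof. by move=> sf sg n; apply: diffn_comp => // i; exact: sg. Qed.

Lemma smooth_at_derive {m : nat} (f : 'cV[R]_m -> R) p v :
  smooth_at f p -> smooth_at (fun q => 'D_v f q) p.
Proof. by move=> sf n; exact: (proj2 (sf n.+1)). Qed.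

Lemma smooth_at_differentiable {m : nat} (f : 'cV[R]_m -> R) p :
  smooth_at f p -> differentiable f p.
Proof. by move=> /(_ 1%N)[/nbhs_singleton]. Qed.

Lemma jac_comp {m k l : nat} (f : 'cV[R]_k -> 'cV[R]_l)
    (g : 'cV[R]_m -> 'cV[R]_k) p :
  (forall i, differentiable (fun q => f q i 0) (g p)) ->
  (forall i, differentiable (fun q => g q i 0) p) ->
  jac (fun q => f (g q)) p = jac f (g p) *m jac g p.
Proof.
move=> df dg; apply/matrixP => i j; rewrite !mxE.
rewrite (@derive_comp_col _ _ (fun q => f q i 0)) //.
by apply: eq_bigr => a _; rewrite !mxE mulrC.
Qed.

Lemma jac_near_id {m : nat} (g : 'cV[R]_m -> 'cV[R]_m) p :
  (\forall q \near p, g q = q) -> jac g p = 1%:M.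
Proof.
move=> gid; apply/matrixP => i j; rewrite !mxE.
rewrite (@near_eq_derive _ _ _ _ (fun q : 'cV[R]_m => q i 0)); last first.
  by apply: filterS gid => q ->.
have := @derive_mx R 'cV[R]_m m 1 idfun p (delta_mx j 0).
move=> /(_ (@derivable_id _ _ _ _)) /matrixP /(_ i 0).
by rewrite derive_id !mxE => <-; rewrite ?eqxx ?andbT.
Qed.

End Smoothness.

Record manifold (R : realType) (m : nat) := Manifold {
  points :> topologicalType;
  manifold_hausdorff : hausdorff_space points;
  manifold_second_countable : @second_countable points;
  chart_index : Type;
  chart_dom : chart_index -> set points;
  chart : chart_index -> points -> 'cV[R]_m;
  chart_inv : chart_index -> 'cV[R]_m -> points;
  chart_at : points -> chart_index;
  chart_atP : forall x, chart_dom (chart_at x) x;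
  chart_dom_open : forall i, open (chart_dom i);
  chart_image_open : forall i, open (chart i @` chart_dom i);
  chartK : forall i x, chart_dom i x -> chart_inv i (chart i x) = x;
  chart_continuous : forall i x, chart_dom i x -> {for x, continuous (chart i)};
  chart_inv_continuous : forall i x,
    chart_dom i x -> {for chart i x, continuous (chart_inv i)};
  chart_smooth : forall i j x, chart_dom i x -> chart_dom j x ->
    forall k, smooth_at (fun p => chart j (chart_inv i p) k 0) (chart i x)
}.

Section Functions.
Context {R : realType} {m : nat} {M : manifold R m}.

Definition smooth_fun_at (f : M -> R) (x : M) : Prop :=
  forall i, chart_dom i x -> smooth_at (fun p => f (chart_inv i p)) (chart i x).

Definition smooth_fun (f : M -> R) : Prop := forall x, smooth_fun_at f x.

Definition smooth_mx_at {a b : nat} (S : M -> 'M[R]_(a, b)) (x : M) : Prop :=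
  forall k l, smooth_fun_at (fun y => S y k l) x.

(* The tangent space at x is identified with R^m by the chart [chart_at x]. *)
Definition de_rham (f : M -> R) (x : M) : 'cV[R]_m :=
  \col_k 'D_(delta_mx k 0)
    (fun p => f (chart_inv (chart_at x) p)) (chart (chart_at x) x).

Lemma near_chart_inv (i : chart_index M) x (P : set M) : chart_dom i x ->
  (\forall y \near x, P y) -> \forall p \near chart i x, P (chart_inv i p).
Proof.
move=> ix Px; apply: (chart_inv_continuous ix); rewrite chartK //; exact: Px.
Qed.

Lemma near_chart_dom (i : chart_index M) x :
  chart_dom i x -> \forall y \near x, chart_dom i y.
Proof. by move=> ix; apply: open_nbhs_nbhs; split=> //; exact: chart_dom_open. Qed.

Lemma near_chart_invK (i : chart_index M) x : chart_dom i x ->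
  \forall p \near chart i x, chart i (chart_inv i p) = p.
Proof.
move=> ix; have : \forall p \near chart i x, (chart i @` chart_dom i) p.
  apply: open_nbhs_nbhs; split; first exact: chart_image_open.
  by exists x.
by apply: filterS => _ [y iy <-]; rewrite chartK.
Qed.

Lemma smooth_fun_near_eq (f g : M -> R) x :
  (\forall y \near x, f y = g y) -> smooth_fun_at f x -> smooth_fun_at g x.
Proof.
move=> fg sf i ix; apply: smooth_at_near_eq (sf i ix).
exact: (near_chart_inv ix fg).
Qed.

(* The Jacobian of the coordinate change from [chart_at x] to [chart i]. *)
Definition tangent_triv (i : chart_index M) (x : M) : 'M[R]_m :=
  jac (fun p => chart i (chart_inv (chart_at x) p)) (chart (chart_at x) x).

Lemma chart_differentiable (i j : chart_index M) x :
  chart_dom i x -> chart_dom j x ->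
  forall k, differentiable (fun p => chart j (chart_inv i p) k 0) (chart i x).
Proof. by move=> ix jx k; apply/smooth_at_differentiable/chart_smooth. Qed.

Lemma jac_chart_comp (i j l : chart_index M) x :
  chart_dom i x -> chart_dom j x -> chart_dom l x ->
  jac (fun p => chart l (chart_inv i p)) (chart i x) =
  jac (fun p => chart l (chart_inv j p)) (chart j x) *m
  jac (fun p => chart j (chart_inv i p)) (chart i x).
Proof.
move=> ix jx lx.
rewrite -[in X in _ = X *m _](chartK ix).
rewrite -(@jac_comp _ _ _ _ (fun p => chart l (chart_inv j p))
  (fun p => chart j (chart_inv i p))) ?chartK //.
- apply/matrixP => a b; rewrite !mxE; apply: near_eq_derive.
  have := near_chart_inv ix (near_chart_dom jx).
  by apply: filterS => p /chartK ->.
- exact: chart_differentiable.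
- exact: chart_differentiable.
Qed.

Lemma tangent_triv_unit i x : chart_dom i x -> tangent_triv i x \in unitmx.
Proof.
move=> ix; have cx := chart_atP x.
have /mulmx1_unit[] // : tangent_triv i x *m
    jac (fun p => chart (chart_at x) (chart_inv i p)) (chart i x) = 1%:M.
by rewrite /tangent_triv -jac_chart_comp // jac_near_id //; exact: near_chart_invK.
Qed.

Lemma tangent_triv_smooth i j x : chart_dom i x -> chart_dom j x ->
  smooth_mx_at (fun y => tangent_triv j y *m invmx (tangent_triv i y)) x.
Proof.
move=> ix jx k l.
pose h p := 'D_(delta_mx l 0) (fun q => chart j (chart_inv i q) k 0) p.
have sh : smooth_fun_at (fun y => h (chart i y)) x.
  move=> c cx; apply: (smooth_at_comp (f := h)); last exact: chart_smooth.
  rewrite chartK //; apply: smooth_at_derive; exact: chart_smooth.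
apply: smooth_fun_near_eq sh; near=> y.
have iy : chart_dom i y by near: y; exact: near_chart_dom.
have jy : chart_dom j y by near: y; exact: near_chart_dom.
rewrite /tangent_triv (jac_chart_comp (chart_atP y) iy jy).
by rewrite mulmxK ?mxE //; exact: tangent_triv_unit.
Unshelve. all: by end_near. Qed.

End Functions.

(* The fibre over every point is R^r as a bare vector space: fibres over
   different points are related only through the local trivialisations
   [triv a x], which are linear isomorphisms from the fibre over x onto the
   model fibre R^r. *)
Record vbundle (R : realType) (m : nat) (M : manifold R m) (r : nat) := VBundle {
  triv_index : Type;
  triv_dom : triv_index -> set M;
  triv : triv_index -> M -> 'M[R]_r;
  triv_cover : forall x, exists a, triv_dom a x;
  triv_dom_open : forall a, open (triv_dom a);
  triv_unit : forall a x, triv_dom a x -> triv a x \in unitmx;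
  triv_smooth : forall a b x, triv_dom a x -> triv_dom b x ->
    smooth_mx_at (fun y => triv b y *m invmx (triv a y)) x
}.

Section Bundles.
Context {R : realType} {m : nat} {M : manifold R m}.

Definition tangent_bundle : vbundle M m :=
  {| triv_index := chart_index M;
     triv_dom := @chart_dom _ _ M;
     triv := tangent_triv;
     triv_cover := fun x => ex_intro _ (chart_at x) (chart_atP x);
     triv_dom_open := @chart_dom_open _ _ M;
     triv_unit := tangent_triv_unit;
     triv_smooth := tangent_triv_smooth |}.

Definition smooth_section {r : nat} (E : vbundle M r) (s : M -> 'cV[R]_r) : Prop :=
  forall a x, @triv_dom _ _ _ _ E a x ->
    smooth_mx_at (fun y => triv a y *m s y) x.

Definition smooth_hom {r s : nat} (E : vbundle M r) (F : vbundle M s)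
    (S : M -> 'M[R]_(s, r)) : Prop :=
  forall a b x, @triv_dom _ _ _ _ E a x -> @triv_dom _ _ _ _ F b x ->
    smooth_mx_at (fun y => triv b y *m S y *m invmx (triv a y)) x.

Section Dual.
Context {r : nat} (E : vbundle M r).

Let dual_triv (a : triv_index E) (x : M) : 'M[R]_r := (invmx (triv a x))^T.

Lemma dual_triv_unit a x : triv_dom a x -> dual_triv a x \in unitmx.
Proof. by move=> ax; rewrite unitmx_tr unitmx_inv triv_unit. Qed.

Lemma dual_triv_smooth a b x : triv_dom a x -> triv_dom b x ->
  smooth_mx_at (fun y => dual_triv b y *m invmx (dual_triv a y)) x.
Proof.
move=> ax bx k l; apply: smooth_fun_near_eq (triv_smooth bx ax l k).
near=> y; have bu : triv b y \in unitmx.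
  apply: triv_unit; near: y; apply: open_nbhs_nbhs; split=> //.
  exact: triv_dom_open.
by rewrite /dual_triv -trmx_inv invmxK -trmx_mul [RHS]mxE.
Unshelve. all: by end_near. Qed.

(* Covectors are columns as well; their pairing with vectors is [pairing]. *)
Definition dual_bundle : vbundle M r :=
  {| triv_index := triv_index E;
     triv_dom := @triv_dom _ _ _ _ E;
     triv := dual_triv;
     triv_cover := @triv_cover _ _ _ _ E;
     triv_dom_open := @triv_dom_open _ _ _ _ E;
     triv_unit := dual_triv_unit;
     triv_smooth := dual_triv_smooth |}.

End Dual.
End Bundles.

Definition pairing {R : realType} {r : nat} (alpha v : 'cV[R]_r) : R :=
  (alpha^T *m v) 0 0.

Section VectorFields.
Context {R : realType} {m : nat} {M : manifold R m}.
Implicit Types (V W : M -> 'cV[R]_m) (f : M -> R).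

Definition vf_act V f : M -> R := fun x => pairing (de_rham f x) (V x).

(* Components of the commutator of V and W in the chart [chart_at x]; the
   coordinate functions are only meaningful near x. *)
Definition vf_bracket V W : M -> 'cV[R]_m := fun x =>
  \col_k (vf_act V (vf_act W (fun y => chart (chart_at x) y k 0)) x -
          vf_act W (vf_act V (fun y => chart (chart_at x) y k 0)) x).

End VectorFields.

(* Lie algebroid structure maps, without axioms; [bracket] is only meaningful
   on smooth sections. *)
Record algebroid {R : realType} {m : nat} (M : manifold R m) (r : nat) := Algebroid {
  bracket : (M -> 'cV[R]_r) -> (M -> 'cV[R]_r) -> M -> 'cV[R]_r;
  anchor : M -> 'M[R]_(m, r)
}.

Section Algebroids.
Context {R : realType} {m : nat} {M : manifold R m} {r : nat}.
Implicit Types (E : vbundle M r) (L : algebroid M r) (X Y Z : M -> 'cV[R]_r).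
Implicit Types (alpha beta phi : M -> 'cV[R]_r) (f g : M -> R).
Implicit Types (N : M -> 'M[R]_r) (x : M).

Definition hom_app {s : nat} (S : M -> 'M[R]_(s, r)) X : M -> 'cV[R]_s :=
  fun x => S x *m X x.

Definition transpose N : M -> 'M[R]_r := fun x => (N x)^T.

Definition eval_form alpha X : M -> R := fun x => pairing (alpha x) (X x).

Definition anchor_act L X f : M -> R := vf_act (hom_app (anchor L) X) f.

Record is_lie_algebroid E L : Prop := {
  anchor_smooth : smooth_hom E tangent_bundle (anchor L);
  bracket_smooth : forall X Y, smooth_section E X -> smooth_section E Y ->
    smooth_section E (bracket L X Y);
  bracket_linear : forall (a : R) X Y Z,
    smooth_section E X -> smooth_section E Y -> smooth_section E Z ->
    bracket L X (fun x => a *: Y x + Z x) =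
    (fun x => a *: bracket L X Y x + bracket L X Z x);
  bracket_antisym : forall X Y, smooth_section E X -> smooth_section E Y ->
    bracket L X Y = (fun x => - bracket L Y X x);
  bracket_jacobi : forall X Y Z,
    smooth_section E X -> smooth_section E Y -> smooth_section E Z ->
    forall x, bracket L X (bracket L Y Z) x + bracket L Y (bracket L Z X) x +
              bracket L Z (bracket L X Y) x = 0;
  bracket_leibniz : forall X Y f,
    smooth_section E X -> smooth_section E Y -> smooth_fun f ->
    bracket L X (fun x => f x *: Y x) =
    (fun x => f x *: bracket L X Y x + anchor_act L X f x *: Y x)
}.

Definition deform L N : algebroid M r := {|
  bracket := fun X Y x =>
    bracket L (hom_app N X) Y x + bracket L X (hom_app N Y) x
    - N x *m bracket L X Y x;
  anchor := fun x => anchor L x *m N x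
|}.

Definition is_nijenhuis E L N : Prop :=
  smooth_hom E E N /\
  forall X Y, smooth_section E X -> smooth_section E Y ->
    bracket L (hom_app N X) (hom_app N Y) = hom_app N (bracket (deform L N) X Y).

(* The Lie algebroid differential on functions, d f = rho^* (df). *)
Definition diff_fun L f : M -> 'cV[R]_r := fun x => (anchor L x)^T *m de_rham f x.

Definition diff_form L alpha X Y : M -> R := fun x =>
  anchor_act L X (eval_form alpha Y) x - anchor_act L Y (eval_form alpha X) x
  - eval_form alpha (bracket L X Y) x.

Definition is_cocycle E L phi : Prop :=
  smooth_section (dual_bundle E) phi /\
  forall X Y, smooth_section E X -> smooth_section E Y ->
    forall x, diff_form L phi X Y x = 0.

Definition diff_fun_twisted L phi f : M -> 'cV[R]_r := fun x =>
  diff_fun L f x + f x *: phi x.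

Definition diff_form_twisted L phi alpha X Y : M -> R := fun x =>
  diff_form L alpha X Y x +
  (eval_form phi X x * eval_form alpha Y x - eval_form phi Y x * eval_form alpha X x).

(* The 1-form i_X d alpha + d (i_X alpha) (twisted by phi), evaluated on Y. *)
Definition lie_form_twisted L phi X alpha Y : M -> R := fun x =>
  diff_form_twisted L phi alpha X Y x +
  eval_form (diff_fun_twisted L phi (eval_form alpha X)) Y x.

(* The section of the dual bundle representing a C^oo(M)-linear functional on
   the smooth sections of E. *)
Definition section_of E (F : (M -> 'cV[R]_r) -> M -> R) : M -> 'cV[R]_r :=
  xget (fun=> 0) [set alpha | smooth_section (dual_bundle E) alpha /\
    forall Y, smooth_section E Y -> eval_form alpha Y = F Y].

End Algebroids.

(* A multivector of degree p at a point is an alternating p-linear form on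
   covectors. Its arguments are packed in a sequence indexed by nat of which
   only the entries of index < p matter, so that multivectors of all degrees
   share the same type. *)
Notation multivector R r := ((nat -> 'cV[R]_r) -> R).

Section Multivectors.
Context {R : realType} {m : nat} {M : manifold R m} {r : nat}.
Implicit Types (E : vbundle M r) (L : algebroid M r) (X Y : M -> 'cV[R]_r).
Implicit Types (P Q S : M -> multivector R r) (f g : M -> R).

Definition upd (v : nat -> 'cV[R]_r) (i : nat) (u : 'cV[R]_r) :=
  fun k => if k == i then u else v k.

Definition is_alternating (p : nat) (w : multivector R r) : Prop :=
  [/\ forall v v', (forall i, (i < p)%N -> v i = v' i) -> w v = w v',
      forall i v (a : R) u u', (i < p)%N ->
        w (upd v i (a *: u + u')) = a * w (upd v i u) + w (upd v i u') &
      forall i j v, (i < j < p)%N -> v i = v j -> w v = 0].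

Definition is_multivector E (p : nat) P : Prop :=
  (forall x, is_alternating p (P x)) /\
  forall alpha : nat -> M -> 'cV[R]_r,
    (forall i, smooth_section (dual_bundle E) (alpha i)) ->
    smooth_fun (fun x => P x (alpha^~ x)).

Definition non_vanishing P : Prop := forall x, exists v, P x v != 0.

Definition mv_fun f : M -> multivector R r := fun x _ => f x.
Definition mv_sec X : M -> multivector R r := fun x v => pairing (v 0%N) (X x).

Definition perm_nat {n : nat} (s : 'S_n) (i : nat) : nat :=
  if insub i is Some k then val (s k) else i.

Definition mv_wedge (p q : nat) P Q : M -> multivector R r := fun x v =>
  (p`! * q`!)%:R^-1 * \sum_(s : 'S_(p + q))
    (-1) ^+ s * P x (fun i => v (perm_nat s i))
              * Q x (fun j => v (perm_nat s (p + j)%N)).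

Definition contract (phi : M -> 'cV[R]_r) (p : nat) P : M -> multivector R r :=
  fun x v => if p is 0 then 0
             else P x (fun i => if i is i'.+1 then v i' else phi x).

(* [sb p q] is the bracket of multivectors of degrees p and q, of degree
   p + q - 1. Signs depend on (p-1)(q-1) and (p-1)q modulo 2 only. *)
Record is_schouten E L
    (sb : nat -> nat -> (M -> multivector R r) -> (M -> multivector R r) ->
          M -> multivector R r) : Prop := {
  schouten_multivector : forall p q P Q,
    is_multivector E p P -> is_multivector E q Q ->
    is_multivector E (p + q).-1 (sb p q P Q);
  schouten_linear : forall p q P Q S (a : R),
    is_multivector E p P -> is_multivector E q Q -> is_multivector E q S ->
    sb p q P (fun x v => a * Q x v + S x v) =
    (fun x v => a * sb p q P Q x v + sb p q P S x v);
  schouten_fun_fun : forall f g, smooth_fun f -> smooth_fun g ->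
    sb 0%N 0%N (mv_fun f) (mv_fun g) = mv_fun (fun=> 0);
  schouten_sec_fun : forall X f, smooth_section E X -> smooth_fun f ->
    sb 1%N 0%N (mv_sec X) (mv_fun f) = mv_fun (anchor_act L X f);
  schouten_sec_sec : forall X Y, smooth_section E X -> smooth_section E Y ->
    sb 1%N 1%N (mv_sec X) (mv_sec Y) = mv_sec (bracket L X Y);
  schouten_antisym : forall p q P Q,
    is_multivector E p P -> is_multivector E q Q ->
    sb p q P Q =
    (fun x v => - ((-1) ^+ (p.+1 * q.+1) * sb q p Q P x v));
  schouten_leibniz : forall p q s P Q S,
    is_multivector E p P -> is_multivector E q Q -> is_multivector E s S ->
    sb p (q + s)%N P (mv_wedge q s Q S) =
    (fun x v => mv_wedge (p + q).-1 s (sb p q P Q) S x v +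
                (-1) ^+ (p.+1 * q) * mv_wedge q (p + s).-1 Q (sb p s P S) x v)
}.

Definition schouten_jacobi
    (sb : nat -> nat -> (M -> multivector R r) -> (M -> multivector R r) ->
          M -> multivector R r)
    (phi : M -> 'cV[R]_r) (p q : nat) P Q : M -> multivector R r := fun x v =>
  sb p q P Q x v + (p%:R - 1) * mv_wedge p q.-1 P (contract phi q Q) x v
  - (-1) ^+ p.+1 * (q%:R - 1) * mv_wedge p.-1 q (contract phi p P) Q x v.

Definition args2 (alpha beta : 'cV[R]_r) : nat -> 'cV[R]_r :=
  nth 0 [:: alpha; beta].

(* The matrix of Q^#, where < beta, Q^# alpha > = Q(alpha, beta) *)
Definition sharp Q : M -> 'M[R]_r := fun x =>
  \matrix_(i, j) Q x (args2 (delta_mx j 0) (delta_mx i 0)).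

Definition of_sharp (S : M -> 'M[R]_r) : M -> multivector R r := fun x v =>
  pairing (v 1%N) (S x *m v 0%N).

Definition is_jacobi_bivector E L phi Q : Prop :=
  is_multivector E 2 Q /\
  exists2 sb, is_schouten E L sb &
    forall x v, schouten_jacobi sb phi 2 2 Q Q x v = 0.

Definition dual_algebroid E L phi Q : algebroid M r := {|
  bracket := fun alpha beta => section_of E (fun Y x =>
    lie_form_twisted L phi (hom_app (sharp Q) alpha) beta Y x
    - lie_form_twisted L phi (hom_app (sharp Q) beta) alpha Y x
    - eval_form (diff_fun_twisted L phi
             (fun y => Q y (args2 (alpha y) (beta y)))) Y x);
  anchor := fun x => anchor L x *m sharp Q x
|}.

End Multivectors.

Section Modular.
Context {R : realType} {m : nat} {M : manifold R m}.

(* The Lie derivative of a form mu of degree m along V, evaluated on vector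
   fields W 0, ..., W (m - 1). *)
Definition lie_volume (V : M -> 'cV[R]_m) (mu : M -> multivector R m)
    (W : nat -> M -> 'cV[R]_m) : M -> R := fun x =>
  vf_act V (fun y => mu y (W^~ y)) x -
  \sum_(i < m) mu x (upd (W^~ x) i (vf_bracket V (W i) x)).

(* A volume form on M: forms are multivectors of the cotangent bundle. *)
Definition is_volume_form (mu : M -> multivector R m) : Prop :=
  is_multivector (dual_bundle tangent_bundle) m mu /\ non_vanishing mu.

Context {r : nat}.
Implicit Types (E : vbundle M r) (L : algebroid M r).

(* The equality of sections of /\^top E (x) /\^top T^*M is evaluated
   on arbitrary covectors v and vector fields W. *)
Definition is_modular_form E L (eta : M -> multivector R r)
    (mu : M -> multivector R m) (xi : M -> 'cV[R]_r) : Prop :=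
  smooth_section (dual_bundle E) xi /\
  exists2 sb, is_schouten E L sb &
    forall X, smooth_section E X ->
    forall W : nat -> M -> 'cV[R]_m, (forall i, smooth_section tangent_bundle (W i)) ->
    forall x v,
      eval_form xi X x * (eta x v * mu x (W^~ x)) =
      sb 1%N r (mv_sec X) eta x v * mu x (W^~ x) +
      eta x v * lie_volume (hom_app (anchor L) X) mu W x.

Definition is_modular_vector_field E L phi P N nu mu (X : M -> 'cV[R]_r) : Prop :=
  exists xiN xi : M -> 'cV[R]_r,
  [/\ is_modular_form (dual_bundle E) (deform (dual_algebroid E L phi P) (transpose N))
        nu mu xiN,
      is_modular_form (dual_bundle E) (dual_algebroid E L phi P) nu mu xi &
      X = (fun x => xiN x - N x *m xi x)].

Definition mul_bivector (N : M -> 'M[R]_r) (P : M -> multivector R r) :=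
  of_sharp (fun x => N x *m sharp P x).

Record is_jacobi_nijenhuis E L phi P N : Prop := {
  jn_lie_algebroid : is_lie_algebroid E L;
  jn_cocycle : is_cocycle E L phi;
  jn_jacobi : is_jacobi_bivector E L phi P;
  jn_nijenhuis : is_nijenhuis E L N;
  jn_sharp : forall x, N x *m sharp P x = sharp P x *m (N x)^T;
  jn_bracket : forall alpha beta,
    smooth_section (dual_bundle E) alpha -> smooth_section (dual_bundle E) beta ->
    bracket (dual_algebroid E L phi (mul_bivector N P)) alpha beta =
    bracket (dual_algebroid E (deform L N) (hom_app (transpose N) phi) P)
      alpha beta
}.

Definition zpow (N : M -> 'M[R]_r) (i : int) : M -> 'M[R]_r := fun x =>
  match i with
  | Posz n => N x ^+ n
  | Negz n => invmx (N x) ^+ n.+1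
  end.

(* ln is 0 on nonpositive reals; the absolute value makes h_0 = ln (det N) where
   det N > 0, and gives it the right differential (tr (N^-1 dN)) where
   det N < 0. *)
Definition hfun (N : M -> 'M[R]_r) (i : int) : M -> R := fun x =>
  if i == 0 then ln `|\det (N x)| else i%:~R^-1 * \tr (zpow N i x).

Definition induced_bivector L (Q : M -> multivector R r) : M -> multivector R m :=
  fun x v => Q x (fun k => (anchor L x)^T *m v k).

Definition induced_field L phi (Q : M -> multivector R r) : M -> 'cV[R]_m :=
  hom_app (anchor L) (hom_app (sharp Q) phi).

(* Sections X + f d/dt of TM x R. *)
Definition tmr_section : Type := ((M -> 'cV[R]_m) * (M -> R))%type.

Definition smooth_tmr_section (s : tmr_section) : Prop :=
  smooth_section tangent_bundle s.1 /\ smooth_fun s.2.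

End Modular.

(* Main.v *)
(* Write K_X for the endomorphism L_X N = [X, N .] - N [X, .], and h_k for the
   functions of the hierarchy. In a local frame K_X is the derivative of the matrix
   of N up to a commutator with that matrix, so tr (N^(k-1) K_X) = X(h_k) for every
   integer k (Jacobi's formula when k = 0). Vanishing of the Nijenhuis torsion reads
   K_{NX} = N K_X, whence N^* d h_k = d h_{k+1} for the differential d of A.

   For the modular vector field, the anchor terms of the two modular forms cancel on
   a section alpha of A^*, and what is left is the difference of the Schouten
   brackets of alpha (deformed by N^* ) and N^* alpha with nu. This difference is a
   function-linear derivation of multivectors extending the endomorphism
   [alpha, N^* .] - N^* [alpha, .] of A^*, so it multiplies nu by its trace, which by
   the same frame computation is the derivative of tr N along alpha. Hence X = d_P h_1,
   and N P^# = P^# N^* gives N^(i+j-1) X = d_{N^i P} h_j. *)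
Require Import Defs.
From HB Require Import structures.
From mathcomp Require Import all_boot all_order all_algebra all_fingroup.
From mathcomp Require Import all_classical all_reals all_analysis.
From mathcomp Require Import ring.

Set Implicit Arguments.
Unset Strict Implicit.
Unset Printing Implicit Defensive.

Import Order.TTheory GRing.Theory Num.Theory numFieldNormedType.Exports.

Local Open Scope classical_set_scope.
Local Open Scope ring_scope.

(** * Smooth functions on Euclidean space *)

Section SmoothCalculus.
Context {R : realType}.

Lemma derive_comp_scalar {m : nat} (f : R -> R) (g : 'cV[R]_m -> R) p (a : R) :
  is_derive (g p) 1 f a -> differentiable g p ->
  differentiable (fun q => f (g q)) p /\
  forall v, 'D_v (fun q => f (g q)) p = a * 'D_v g p.
Proof.
move=> [fd <-] dg; have df : differentiable f (g p) by exact/derivable1_diffP.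
have dfg : differentiable (fun q => f (g q)) p.
  by rewrite -[fun q => _]/(f \o g); exact: differentiable_comp.
split=> // v; rewrite -[fun q => _]/(f \o g) deriveE // diff_comp //=.
by rewrite -[X in 'd f _ X]mulr1 [LHS]linearZ -!deriveE // [RHS]mulrC.
Qed.

Lemma near_neq0 {T : topologicalType} (f : T -> R) p :
  {for p, continuous f} -> f p != 0 -> \forall q \near p, f q != 0.
Proof.
move=> cf fp; apply: (cf [set y | y != 0]).
by apply: open_nbhs_nbhs; split => //; exact: open_neq.
Qed.

(** The derivative of 1/f is -(1/f)^2 times that of f, so each order of differentiability of 1/f
    follows from the preceding order of 1/f itself. *)
Lemma diffn_inv {m : nat} n (f : 'cV[R]_m -> R) p :
  diffn n f p -> f p != 0 -> diffn n (fun q => (f q)^-1) p.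
Proof.
elim: n f p => [//|n IH] f p Df fp; have [df dvf] := Df.
have f0 : \forall q \near p, f q != 0.
  by apply: near_neq0 fp; apply/differentiable_continuous; exact: nbhs_singleton df.
split; first by near=> q; apply: differentiableV; near: q.
move=> v; have Di := IH _ _ (diffnW Df) fp.
apply: near_eq_diffn (diffnM (diffn_cst n (-1) p) (diffnM (diffnM Di Di) (dvf v))).
near=> q; rewrite deriveV; first by rewrite /GRing.scale /= mulN1r mulNr -invfM -expr2.
  by near: q.
by apply: diff_derivable; near: q.
Unshelve. all: by end_near. Qed.

(** For t < 0 the function is [ln] after negation, and the two signs cancel. *)
Lemma is_derive_ln_norm (t : R) : t != 0 ->
  is_derive t 1 (fun s => ln `|s|) t^-1.
Proof.
rewrite neq_lt => /orP[t0|t0].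
  apply: (@near_eq_is_derive R R^o R^o (@ln R \o -%R)).
  - near=> s; rewrite /= ltr0_norm //; near: s; exact: lt_nbhsl.
  - have H := is_derive1_ln (x := - t).
    have H' : is_derive (- t) (1 : R^o) (@ln R) (- t)^-1 by apply: H; rewrite oppr_gt0.
    have := is_derive1_comp H' (is_deriveNid t (1 : R^o)).
    by rewrite invrN mulrNN mulr1.
apply: (@near_eq_is_derive R R^o R^o (@ln R)); last exact: is_derive1_ln.
near=> s; rewrite gtr0_norm //; near: s; exact: lt_nbhsr.
Unshelve. all: by end_near. Qed.

Lemma diffn_ln_norm {m : nat} n (f : 'cV[R]_m -> R) p :
  diffn n f p -> f p != 0 -> diffn n (fun q => ln `|f q|) p.
Proof.
case: n => [//|n] Df fp; have [df dvf] := Df.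
have f0 : \forall q \near p, f q != 0.
  by apply: near_neq0 fp; apply/differentiable_continuous; exact: nbhs_singleton df.
have H q : f q != 0 -> differentiable f q -> 
    differentiable (fun q => ln `|f q|) q /\
    forall v, 'D_v (fun q => ln `|f q|) q = (f q)^-1 * 'D_v f q.
  move=> fq0 dfq; exact: (derive_comp_scalar (is_derive_ln_norm fq0) dfq).
split; first by near=> q; apply: (H _ _ _).1; near: q.
move=> v; apply: near_eq_diffn (diffnM (diffn_inv (diffnW Df) fp) (dvf v)).
by near=> q; rewrite (H _ _ _).2 //; near: q.
Unshelve. all: by end_near. Qed.

(** The functions t^(-k) exp(-1/t), extended by 0 to t <= 0. Bump functions use k = 0; the other k
    enter through derivatives. *)
Definition flat (k : nat) (t : R) : R := if 0 < t then t ^- k * expR (- t^-1) else 0.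

(** A single term of the exponential series gives exp(1/t) >= t^(-(k+2)) / (k+2)!. The quadratic
    bound is what makes the difference quotient at 0 tend to 0. *)
Lemma flat_bound k t : `|flat k t| <= k.+2`!%:R * t ^+ 2.
Proof.
rewrite /flat; case: ifPn => [t0|_]; last by rewrite normr0 mulr_ge0 ?sqr_ge0.
rewrite ger0_norm ?mulr_ge0 ?expR_ge0 ?invr_ge0 ?exprn_ge0 ?(ltW t0) //.
have /(expR_ge1Dxn k.+1) H : 0 <= t^-1 by rewrite invr_ge0 ltW.
have f0 : 0 < k.+2`!%:R :> R by rewrite ltr0n fact_gt0.
have {H} : t^-1 ^+ k.+2 / k.+2`!%:R <= expR t^-1.
  by apply: le_trans H; rewrite lerDr.
rewrite ler_pdivrMr // expRN => H.
have -> : t ^- k = t ^+ 2 * t^-1 ^+ k.+2.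
  by rewrite exprVn -(addn2 k) exprD invfM mulrCA mulfV ?mulr1 // expf_neq0 ?gt_eqF.
rewrite ler_pdivrMr ?expR_gt0 // [X in _ <= X]mulrAC [X in _ <= X]mulrC.
rewrite ler_wpM2l ?sqr_ge0 //.
by rewrite mulrC.
Qed.

Lemma is_derive_flat (k : nat) (t : R) :
  is_derive t 1 (flat k) (flat k.+2 t - k%:R * flat k.+1 t).
Proof.
have [t0|t0|<-] := ltgtP 0 t.
- apply: (@near_eq_is_derive R R^o R^o (fun s => s ^- k * expR (- s^-1))).
    by near=> s; rewrite /flat ifT //; near: s; exact: lt_nbhsr.
  have tn : t != 0 by rewrite gt_eqF.
  (* In the variable u = 1/s no negative power occurs, and the chain rule applies. *)
  have -> : (fun s : R => s ^- k * expR (- s^-1)) =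
      (fun u => u ^+ k * expR (- u)) \o (fun s => s^-1).
    by apply/funext => s /=; rewrite exprVn.
  have dV : is_derive t (1 : R^o) (fun s : R^o => s^-1) (- t ^- 2 *: 1).
    exact: is_deriveV.
  have dE : is_derive t^-1 (1 : R^o) (fun u : R^o => u ^+ k * expR (- u))
      (k%:R * t^-1 ^+ k.-1 * expR (- t^-1) - t^-1 ^+ k * expR (- t^-1)).
    have dX : is_derive t^-1 (1 : R^o) ((id : R^o -> R^o) ^+ k)
        ((k%:R * t^-1 ^+ k.-1) *: 1) by exact: is_deriveX.
    have dexp : is_derive t^-1 (1 : R^o) (@expR R \o -%R)
        (expR (- t^-1) * -1).
      exact: (is_derive1_comp (is_derive_expR _) (is_deriveNid _ (1 : R^o))).
    have := is_deriveM dX dexp; rewrite /GRing.scale /= mulrN1 mulr1 exprfctE.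
    by rewrite mulrN addrC [in X in X - _]mulrC.
  have := is_derive1_comp dE dV; rewrite /flat !ifT //.
  congr (is_derive _ _ _ _); rewrite /GRing.scale /= mulr1 -!exprVn.
  case: (k) => [|k'] /=; first by ring.
  move: (k'.+1%:R : R) (expR _) => c e; rewrite !(exprS _ _.+1) exprS. ring.
- rewrite /flat !ifF ?le_gtF ?(ltW t0) // mulr0 subr0.
  apply: (@near_eq_is_derive R R^o R^o (cst 0)).
    by near=> s; rewrite /flat le_gtF // ltW //; near: s; exact: lt_nbhsl.
rewrite {2 3}/flat ltxx mulr0 subr0.
(* At 0 the derivative is the limit of the difference quotient, which [flat_bound] bounds by a
   multiple of |h|. *)
suff H : (fun h : R => h^-1 *: (flat k (h *: 1 + 0) - flat k 0)) @ 0^' --> (0 : R).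
  split; first by apply/cvg_ex; exists 0.
  exact: cvg_lim H.
apply/cvgr0Pnorm_lt => e e0; have C0 : 0 < k.+2`!%:R :> R by rewrite ltr0n fact_gt0.
near=> h; have h0 : h != 0 by near: h; exact: nbhs_dnbhs_neq.
rewrite /= addr0 {2}/flat ltxx subr0 /GRing.scale /= mulr1 normrM normfV.
rewrite ltr_pdivrMl ?normr_gt0 //; apply: le_lt_trans (flat_bound _ _) _.
rewrite -real_normK ?num_real // expr2 mulrA mulrC ltr_pM2l ?normr_gt0 //.
rewrite -ltr_pdivlMl // mulrC.
near: h; apply: dnbhs0_lt; exact: divr_gt0.
Unshelve. all: by end_near. Qed.

(** Differentiating [flat k] produces [flat k.+1] and [flat k.+2], so the induction on n treats all
    k at once. *)
Lemma diffn_flat {m : nat} n k (f : 'cV[R]_m -> R) p :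
  diffn n f p -> diffn n (fun q => flat k (f q)) p.
Proof.
elim: n k f p => [//|n IH] k f p Df; have [df dvf] := Df.
have H q : differentiable f q -> differentiable (fun q => flat k (f q)) q /\
    forall v, 'D_v (fun q => flat k (f q)) q =
      (flat k.+2 (f q) - k%:R * flat k.+1 (f q)) * 'D_v f q.
  by move=> dfq; exact: (derive_comp_scalar (is_derive_flat k (f q)) dfq).
split; first by near=> q; apply: (H _ _).1; near: q.
move=> v; have D1 := IH k.+1 _ _ (diffnW Df); have D2 := IH k.+2 _ _ (diffnW Df).
apply: near_eq_diffn (diffnM (diffnD D2 (diffnM (diffn_cst n (- k%:R) p) D1)) (dvf v)).
by near=> q; rewrite (H _ _).2 ?mulNr //; near: q.
Unshelve. all: by end_near. Qed.

Lemma diffn_coord {m : nat} n (i : 'I_m) (p : 'cV[R]_m) :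
  diffn n (fun q : 'cV[R]_m => q i 0) p.
Proof.
case: n => [//|n]; split; first by near=> q; exact: differentiable_coord.
move=> v; apply: near_eq_diffn (diffn_cst n (v i 0) p); near=> q; apply/esym.
have := @derive_mx R 'cV[R]_m m 1 id q v (@derivable_id _ _ _ _).
by rewrite derive_id => /matrixP/(_ i 0); rewrite mxE.
Unshelve. all: by end_near. Qed.

Lemma diffn_prod {m k : nat} n (f : 'I_k -> 'cV[R]_m -> R) p :
  (forall i, diffn n (f i) p) -> diffn n (fun q => \prod_i f i q) p.
Proof.
move=> df; suff H (s : seq 'I_k) : diffn n (fun q => \prod_(i <- s) f i q) p by [].
elim: s => [|i s IH].
  by under eq_fun do rewrite big_nil; exact: diffn_cst.
by under eq_fun do rewrite big_cons; exact: diffnM.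
Qed.

Lemma bump_col {m : nat} (p : 'cV[R]_m) e : 0 < e ->
  exists b : 'cV[R]_m -> R, [/\ forall q, smooth_at b q, b p != 0 &
    forall q, b q != 0 -> forall k, `|q k 0 - p k 0| <= e].
Proof.
(* A product of one-dimensional bumps: the factor of coordinate k is nonzero exactly when |q_k -
   p_k| < e. *)
move=> e0; exists (fun q => \prod_k flat 0 (e ^+ 2 - (q k 0 - p k 0) ^+ 2)); split.
- move=> q n; apply: diffn_prod => k; apply: diffn_flat.
  have D : diffn n (fun q : 'cV[R]_m => q k 0 + - p k 0) q.
    by apply: diffnD; [exact: diffn_coord|exact: diffn_cst].
  have := diffnD (diffn_cst n (e ^+ 2) q) (diffnM (diffn_cst n (- 1) q) (diffnM D D)).
  by under eq_fun do rewrite mulN1r -expr2.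
- apply/prodf_neq0 => k _; rewrite /flat subrr expr0n subr0 exprn_gt0 //.
  by rewrite expr0 invr1 mul1r gt_eqF ?expR_gt0.
move=> q /prodf_neq0 H k; have := H k isT; rewrite /flat; case: ifP => [|_ /eqP//].
by rewrite subr_gt0 -ltr_sqrt ?exprn_gt0 // !sqrtr_sqr (gtr0_norm e0) => /ltW.
Qed.

Lemma box_compact {m : nat} (p : 'cV[R]_m) (e : R) :
  compact [set q : 'cV[R]_m | forall k, `|q k 0 - p k 0| <= e].
Proof.
pose A (k : 'I_m) : set R := `[p k 0 - e, p k 0 + e]%classic.
have -> : [set q : 'cV[R]_m | forall k, `|q k 0 - p k 0| <= e] =
    trmx @` [set v : 'rV[R]_m | forall i, A i (v ord0 i)].
  apply/seteqP; split=> [q /= qe|_ /= [v vA <-] k].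
    exists q^T; last by rewrite trmxK.
    by move=> i; rewrite /A /= mxE in_itv /= -ler_distlC distrC.
  by have := vA k; rewrite /A /= in_itv /= mxE -ler_distlC distrC.
apply: continuous_compact.
  apply: continuous_subspaceT => v S [B nB BS]; exists (fun i j => B j i).
    by move=> i j; have := nB j i; rewrite mxE.
  by move=> w wB; apply: BS => i j; rewrite mxE; exact: wB.
by apply: rV_compact => i; exact: segment_compact.
Qed.

End SmoothCalculus.

(** * Smooth functions and matrices on a manifold *)

Section ManifoldCalculus.
Context {R : realType} {m : nat} {M : manifold R m}.
Implicit Types (x y : M) (f g : M -> R).

Lemma smooth_fun_at_cst c x : smooth_fun_at (fun=> c) x.
Proof. by move=> i ix n; exact: diffn_cst. Qed.

Lemma smooth_fun_atD f g x : smooth_fun_at f x -> smooth_fun_at g x ->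
  smooth_fun_at (fun y => f y + g y) x.
Proof. by move=> sf sg i ix n; apply: diffnD; [exact: sf|exact: sg]. Qed.

Lemma smooth_fun_atM f g x : smooth_fun_at f x -> smooth_fun_at g x ->
  smooth_fun_at (fun y => f y * g y) x.
Proof. by move=> sf sg i ix n; apply: diffnM; [exact: sf|exact: sg]. Qed.

Lemma smooth_fun_at_sum {k : nat} (f : 'I_k -> M -> R) x :
  (forall i, smooth_fun_at (f i) x) -> smooth_fun_at (fun y => \sum_i f i y) x.
Proof. by move=> sf i ix n; apply: diffn_sum => j; exact: sf. Qed.

Lemma smooth_fun_at_prod {k : nat} (f : 'I_k -> M -> R) x :
  (forall i, smooth_fun_at (f i) x) -> smooth_fun_at (fun y => \prod_i f i y) x.
Proof. by move=> sf i ix n; apply: diffn_prod => j; exact: sf. Qed.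

Lemma smooth_fun_at_inv f x : smooth_fun_at f x -> f x != 0 ->
  smooth_fun_at (fun y => (f y)^-1) x.
Proof. by move=> sf f0 i ix n; apply: diffn_inv; [exact: sf|rewrite chartK]. Qed.

Lemma smooth_fun_at_ln_norm f x : smooth_fun_at f x -> f x != 0 ->
  smooth_fun_at (fun y => ln `|f y|) x.
Proof. by move=> sf f0 i ix n; apply: diffn_ln_norm; [exact: sf|rewrite chartK]. Qed.

Lemma smooth_mx_atM {a b c : nat} (S : M -> 'M[R]_(a, b)) (T : M -> 'M[R]_(b, c)) x :
  smooth_mx_at S x -> smooth_mx_at T x -> smooth_mx_at (fun y => S y *m T y) x.
Proof.
move=> sS sT i j.
have := smooth_fun_at_sum (fun k => smooth_fun_atM (sS i k) (sT k j)).
by apply: smooth_fun_near_eq; apply: nearW => y; rewrite mxE.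
Qed.

Lemma smooth_mx_near_eq {a b : nat} (S T : M -> 'M[R]_(a, b)) x :
  (\forall y \near x, S y = T y) -> smooth_mx_at S x -> smooth_mx_at T x.
Proof.
by move=> ST sS i j; apply: smooth_fun_near_eq (sS i j); apply: filterS ST => y ->.
Qed.

Lemma smooth_mx_at_cst {a b : nat} (A : 'M[R]_(a, b)) x : smooth_mx_at (fun=> A) x.
Proof. by move=> i j; exact: smooth_fun_at_cst. Qed.

Lemma smooth_mx_atD {a b : nat} (S T : M -> 'M[R]_(a, b)) x :
  smooth_mx_at S x -> smooth_mx_at T x -> smooth_mx_at (fun y => S y + T y) x.
Proof.
move=> sS sT i j; apply: smooth_fun_near_eq (smooth_fun_atD (sS i j) (sT i j)).
by apply: nearW => y; rewrite mxE.
Qed.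

Lemma smooth_mx_atZ {a b : nat} f (S : M -> 'M[R]_(a, b)) x :
  smooth_fun_at f x -> smooth_mx_at S x -> smooth_mx_at (fun y => f y *: S y) x.
Proof.
move=> sf sS i j; apply: smooth_fun_near_eq (smooth_fun_atM sf (sS i j)).
by apply: nearW => y; rewrite mxE.
Qed.

Lemma smooth_mx_at_tr {a b : nat} (S : M -> 'M[R]_(a, b)) x :
  smooth_mx_at S x -> smooth_mx_at (fun y => (S y)^T) x.
Proof.
move=> sS i j; apply: smooth_fun_near_eq (sS j i).
by apply: nearW => y; rewrite mxE.
Qed.

Lemma smooth_det {a : nat} (S : M -> 'M[R]_a) x :
  smooth_mx_at S x -> smooth_fun_at (fun y => \det (S y)) x.
Proof.
move=> sS i ix n; rewrite /determinant.
suff H (s : seq 'S_a) : diffn n (fun p => \sum_(t <- s)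
    (-1) ^+ t * \prod_j S (chart_inv i p) j (t j)) (chart i x) by exact: H.
elim: s => [|t s IH].
  by under eq_fun do rewrite big_nil; exact: diffn_cst.
under eq_fun do rewrite big_cons.
apply: diffnD => //; apply: diffnM; first exact: diffn_cst.
by apply: diffn_prod => j; exact: sS.
Qed.

Lemma smooth_mxtrace {a : nat} (S : M -> 'M[R]_a) x :
  smooth_mx_at S x -> smooth_fun_at (fun y => \tr (S y)) x.
Proof. by move=> sS; exact: smooth_fun_at_sum. Qed.

(** Cramer's rule: the entries of the adjugate are determinants, and near x the inverse is the
    adjugate divided by the determinant. *)
Lemma smooth_invmx {a : nat} (S : M -> 'M[R]_a) x :
  smooth_mx_at S x -> (\forall y \near x, S y \in unitmx) ->
  smooth_mx_at (fun y => invmx (S y)) x.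
Proof.
move=> sS uS; have d0 : \det (S x) != 0.
  by rewrite -unitfE; exact: nbhs_singleton uS.
have sadj : smooth_mx_at (fun y => \adj (S y)) x.
  move=> i j; apply: (@smooth_fun_near_eq _ _ _ (fun y =>
      (-1) ^+ (j + i) * \det (row' j (col' i (S y))))).
    by apply: nearW => y; rewrite mxE.
  apply: smooth_fun_atM; first exact: smooth_fun_at_cst.
  apply: smooth_det => k l; apply: smooth_fun_near_eq (sS (lift j k) (lift i l)).
  by apply: nearW => y; rewrite !mxE.
have := smooth_mx_atZ (smooth_fun_at_inv (smooth_det sS) d0) sadj.
by apply: smooth_mx_near_eq; apply: filterS uS => y uy; rewrite /invmx uy.
Qed.

Lemma smooth_expmx {a : nat} (S : M -> 'M[R]_a) n x :
  smooth_mx_at S x -> smooth_mx_at (fun y => S y ^+ n) x.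
Proof.
move=> sS; elim: n => [|n IH].
  by under eq_fun do rewrite expr0; exact: smooth_mx_at_cst.
have H := smooth_mx_atM sS IH; by under eq_fun do rewrite exprS.
Qed.

(** * Derivations *)

Definition lie_at x (v : 'cV[R]_m) f : R := pairing (de_rham f x) v.

(** For smooth f the coordinate formula is a directional derivative in the chart, to which the usual
    rules of calculus apply. *)
Lemma lie_atE x v f : smooth_fun_at f x ->
  lie_at x v f = 'D_v (fun p => f (chart_inv (chart_at x) p)) (chart (chart_at x) x).
Proof.
move=> sf; rewrite derive_jac; last first.
  by apply: smooth_at_differentiable; exact: sf (chart_atP x).
by rewrite /lie_at /pairing mxE; apply: eq_bigr => k _; rewrite !mxE mulrC.
Qed.

Let drv x v f : smooth_fun_at f x ->
  derivable (fun p => f (chart_inv (chart_at x) p)) (chart (chart_at x) x) v.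
Proof.
by move=> sf; apply/diff_derivable/smooth_at_differentiable; exact: sf (chart_atP x).
Qed.

Lemma lie_at_near_eq x v f g : (\forall y \near x, f y = g y) ->
  lie_at x v f = lie_at x v g.
Proof.
move=> fg; congr (pairing _ _); apply/matrixP => k l; rewrite !mxE.
by apply: near_eq_derive; exact: near_chart_inv (chart_atP x) fg.
Qed.

Lemma lie_at_cst x v c : lie_at x v (fun=> c) = 0.
Proof. by rewrite lie_atE; [exact: derive_cst|exact: smooth_fun_at_cst]. Qed.

Lemma lie_atD x v f g : smooth_fun_at f x -> smooth_fun_at g x ->
  lie_at x v (fun y => f y + g y) = lie_at x v f + lie_at x v g.
Proof.
move=> sf sg; rewrite !lie_atE //; last exact: smooth_fun_atD.
by rewrite -deriveD //; exact: drv.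
Qed.

Lemma lie_atM x v f g : smooth_fun_at f x -> smooth_fun_at g x ->
  lie_at x v (fun y => f y * g y) = f x * lie_at x v g + g x * lie_at x v f.
Proof.
move=> sf sg; rewrite !lie_atE //; last exact: smooth_fun_atM.
rewrite -[fun p => _]/((fun p => f (chart_inv (chart_at x) p)) *
  (fun p => g (chart_inv (chart_at x) p))) deriveM; [|exact: drv..].
by rewrite chartK //; exact: chart_atP.
Qed.

Lemma lie_at_sum {k : nat} (f : 'I_k -> M -> R) x v :
  (forall i, smooth_fun_at (f i) x) ->
  lie_at x v (fun y => \sum_i f i y) = \sum_i lie_at x v (f i).
Proof.
move=> sf; rewrite lie_atE; last exact: smooth_fun_at_sum.
rewrite (_ : (fun p => _) = \sum_i (fun p => f i (chart_inv (chart_at x) p))); last first.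
  by apply/funext => p; rewrite fct_sumE.
rewrite derive_sum; last by move=> i; exact: drv.
by apply: eq_bigr => i _; rewrite lie_atE.
Qed.

Lemma lie_at_ln_norm x v f : smooth_fun_at f x -> f x != 0 ->
  lie_at x v (fun y => ln `|f y|) = (f x)^-1 * lie_at x v f.
Proof.
move=> sf f0; rewrite !lie_atE //; last exact: smooth_fun_at_ln_norm.
have xx : chart_inv (chart_at x) (chart (chart_at x) x) = x.
  by rewrite chartK //; exact: chart_atP.
have [|//|_ H] := @derive_comp_scalar _ _ (fun t => ln `|t|)
    (fun p => f (chart_inv (chart_at x) p)) (chart (chart_at x) x) (f x)^-1.
- by rewrite xx; exact: is_derive_ln_norm.
- by apply: smooth_at_differentiable; exact: sf (chart_atP x).
exact: H.
Qed.

(** * Cut-off functions *)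

(** A Euclidean bump is pulled back by a chart and extended by zero. The image C of a closed box is
    compact, hence closed because M is Hausdorff, so the extension vanishes near every point outside
    C and is smooth there. *)
Lemma bump x (U : set M) : nbhs x U -> exists chi : M -> R,
  [/\ smooth_fun chi, chi x != 0 &
      exists C, [/\ closed C, C `<=` U & forall y, ~ C y -> chi y = 0]].
Proof.
move=> Ux; set i := chart_at x; have ix : chart_dom i x := chart_atP x.
pose p := chart i x.
have : \forall q \near p, (chart i @` chart_dom i) q /\ U (chart_inv i q).
  near=> q; split; near: q; last exact: near_chart_inv ix Ux.
  by apply: open_nbhs_nbhs; split; [exact: chart_image_open|exists x].
move=> /nbhs_ballP[e /= e0 pe].
(* Half the radius keeps the closed box inside the open ball. *)
have e2 : 0 < e / 2 by rewrite divr_gt0.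
pose B := [set q : 'cV[R]_m | forall k, `|q k 0 - p k 0| <= e / 2].
have BP q : B q -> (chart i @` chart_dom i) q /\ U (chart_inv i q).
  move=> Bq; apply: pe; split => // k l; rewrite ord1 /ball /= distrC.
  by apply: le_lt_trans (Bq k) _; rewrite ltr_pdivrMr // ltr_pMr // ltr1n.
pose C := chart_inv i @` B.
have Cdom y : C y -> chart_dom i y.
  by move=> [q Bq <-]; have [[z iz <-] _] := BP q Bq; rewrite chartK.
have Cclosed : closed C.
  apply: compact_closed; first exact: manifold_hausdorff.
  apply: continuous_compact; last exact: box_compact.
  apply: continuous_in_subspaceT => q /set_mem Bq.
  by have [[z iz <-] _] := BP q Bq; exact: chart_inv_continuous.
have [b [bsm bp bB]] := bump_col p e2.
pose chi y := if `[< C y >] then b (chart i y) else 0.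
(* On the whole chart domain, not only on C, chi is b in coordinates, because b vanishes outside the
   box. *)
have chiE y : chart_dom i y -> chi y = b (chart i y).
  move=> iy; rewrite /chi; case: asboolP => // nC.
  have [->//|bn] := eqVneq (b (chart i y)) 0; exfalso; apply: nC.
  by exists (chart i y); [exact: bB|exact: chartK].
have chi0 y : ~ C y -> chi y = 0 by move=> nC; rewrite /chi; case: asboolP.
exists chi; split.
- move=> y; have [Cy|nCy] := pselect (C y).
    apply: (@smooth_fun_near_eq _ _ _ (fun z => b (chart i z))).
      by apply: filterS (near_chart_dom (Cdom y Cy)) => z /chiE ->.
    move=> j jy; apply: (@smooth_at_comp _ _ _ b); first exact: bsm.
    by apply: chart_smooth => //; exact: Cdom.
  apply: (@smooth_fun_near_eq _ _ _ (fun z => 0)); last exact: smooth_fun_at_cst.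
  have : nbhs y (~` C) by apply: open_nbhs_nbhs; split => //; exact: closed_openC.
  by apply: filterS => z /chi0 ->.
- by rewrite chiE.
- exists C; split => // y [q Bq <-]; exact: (BP q Bq).2.
Unshelve. all: by end_near. Qed.

(** The last clause turns functions smooth only on the trivialisation domain into globally smooth
    ones: the support of chi lies in a closed set inside the open domain, so the product is zero
    near every point outside that set. *)
Lemma cutoff {r : nat} (E : vbundle M r) x : exists a chi,
  [/\ @triv_dom _ _ _ _ E a x, smooth_fun chi, chi x != 0,
      forall y, ~ @triv_dom _ _ _ _ E a y -> chi y = 0 &
      forall f y, (@triv_dom _ _ _ _ E a y -> smooth_fun_at f y) ->
        smooth_fun_at (fun z => chi z * f z) y].
Proof.
have [a ax] := triv_cover E x.
have Ux : nbhs x (@triv_dom _ _ _ _ E a).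
  by apply: open_nbhs_nbhs; split=> //; exact: triv_dom_open.
have [chi [schi chix [C [clC CU chi0]]]] := bump Ux.
exists a, chi; split => //; first by move=> y ny; apply: chi0 => /CU.
move=> f y sf; have [Cy|nCy] := pselect (C y).
  by apply: smooth_fun_atM; [exact: schi|exact/sf/CU].
apply: (@smooth_fun_near_eq _ _ _ (fun z => 0)); last exact: smooth_fun_at_cst.
have : nbhs y (~` C) by apply: open_nbhs_nbhs; split => //; exact: closed_openC.
by apply: filterS => z /chi0 ->; rewrite mul0r.
Qed.

End ManifoldCalculus.

(** * Integer powers of a matrix and their invariants *)

Section MatrixPowers.
Context {R : realType} {r : nat}.
Implicit Types (A B S T : 'M[R]_r) (k l : int).

(* [zpow N k x] and [hfun N k x] unfold to [mxz (N x) k] and [hmx k (N x)]. *)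
Definition mxz A k : 'M[R]_r :=
  match k with
  | Posz n => A ^+ n
  | Negz n => invmx A ^+ n.+1
  end.

Definition hmx k A : R := if k == 0 then ln `|\det A| else k%:~R^-1 * \tr (mxz A k).

Lemma expmxS A n : A ^+ n.+1 = A *m A ^+ n.
Proof. by rewrite exprS. Qed.

Lemma expmxSr A n : A ^+ n.+1 = A ^+ n *m A.
Proof. by rewrite exprSr. Qed.

(** The matrix S is arbitrary: besides a change of trivialisation it is later the transpose of
    [sharp P], which may be degenerate, or A itself, which gives commutation of A with its
    powers. *)
Lemma mxz_intertwine A B S k : A \in unitmx -> B \in unitmx ->
  S *m A = B *m S -> S *m mxz A k = mxz B k *m S.
Proof.
move=> uA uB SAB.
have expS (A' B' : 'M[R]_r) n : S *m A' = B' *m S -> S *m A' ^+ n = B' ^+ n *m S.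
  move=> SAB'; elim: n => [|n IH]; first by rewrite !expr0 mulmx1 mul1mx.
  by rewrite !expmxS mulmxA SAB' -mulmxA IH mulmxA.
case: k => n; apply: expS => //.
by rewrite -[LHS](mulKmx uB) [B *m _]mulmxA -SAB -!mulmxA mulmxV ?mulmx1.
Qed.

Lemma mxzS A k : A \in unitmx -> mxz A (k + 1) = A *m mxz A k.
Proof.
move=> uA; case: k => [n|[|n]].
- by rewrite -PoszD addn1 /= expmxS.
- by rewrite /= expr0 expr1 mulmxV.
have -> : Negz n.+1 + 1 = Negz n by rewrite !NegzE -[n.+2]addn1 PoszD opprD subrK.
by rewrite /mxz [in RHS]expmxS mulKVmx.
Qed.

Lemma mxzP A k : A \in unitmx -> mxz A (k - 1) = invmx A *m mxz A k.
Proof. by move=> uA; rewrite -{2}(subrK 1 k) mxzS // mulKmx. Qed.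

Lemma mxz_tr A k : mxz A^T k = (mxz A k)^T.
Proof.
have T (B : 'M[R]_r) n : B^T ^+ n = (B ^+ n)^T.
  elim: n => [|n IH]; first by rewrite !expr0 trmx1.
  by rewrite expmxS expmxSr trmx_mul IH.
by case: k => n; rewrite /mxz -?trmx_inv T.
Qed.

(** Determinant and trace are conjugation invariant; this allows the functions of the hierarchy to
    be computed in any trivialisation. *)
Lemma hmx_conj A B S k : A \in unitmx -> B \in unitmx -> S \in unitmx ->
  S *m A = B *m S -> hmx k A = hmx k B.
Proof.
move=> uA uB uS SAB; rewrite /hmx; case: ifP => _.
  have := congr1 determinant SAB; rewrite !det_mulmx mulrC => /mulIf -> //.
  by rewrite -unitfE.
congr (_ * _); have := mxz_intertwine k uA uB SAB.
by move=> /(congr1 (mulmx (invmx S))); rewrite mulKmx // => ->; rewrite mxtrace_mulC mulmxK.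
Qed.

(* Multilinearity of [det] gives the derivative of [det] at G in the direction H. *)
Lemma sum_det_row_subst (G H : 'M[R]_r) :
  \sum_i \det (\matrix_(k, l) (if k == i then H k l else G k l)) = \tr (\adj G *m H).
Proof.
rewrite mxtrace_mulC; apply: eq_bigr => i _; rewrite (expand_det_row _ i) mxE.
apply: eq_bigr => j _; rewrite !mxE eqxx; congr (_ * (_ * \det _)).
by apply/matrixP => k l; rewrite !mxE eq_sym (negbTE (neq_lift _ _)).
Qed.

End MatrixPowers.

(** * Derivatives of matrix-valued functions *)

Section MatrixDerivations.
Context {R : realType} {m : nat} {M : manifold R m}.
Implicit Types (x : M) (v : 'cV[R]_m).

Definition lie_mx {a b : nat} x v (S : M -> 'M[R]_(a, b)) : 'M[R]_(a, b) :=
  \matrix_(i, j) lie_at x v (fun y => S y i j).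

Lemma lie_mx_near_eq {a b : nat} x v (S T : M -> 'M[R]_(a, b)) :
  (\forall y \near x, S y = T y) -> lie_mx x v S = lie_mx x v T.
Proof.
move=> ST; apply/matrixP => i j; rewrite !mxE; apply: lie_at_near_eq.
by apply: filterS ST => y ->.
Qed.

Lemma lie_mx_cst {a b : nat} x v (A : 'M[R]_(a, b)) : lie_mx x v (fun=> A) = 0.
Proof. by apply/matrixP => i j; rewrite !mxE lie_at_cst. Qed.

Lemma lie_mxM {a b c : nat} x v (S : M -> 'M[R]_(a, b)) (T : M -> 'M[R]_(b, c)) :
  smooth_mx_at S x -> smooth_mx_at T x ->
  lie_mx x v (fun y => S y *m T y) = lie_mx x v S *m T x + S x *m lie_mx x v T.
Proof.
move=> sS sT; apply/matrixP => i j; rewrite !mxE.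
rewrite (@lie_at_near_eq _ _ _ _ _ _ (fun y => \sum_k S y i k * T y k j)); last first.
  by apply: nearW => y; rewrite mxE.
rewrite lie_at_sum; last by move=> k; exact: smooth_fun_atM.
rewrite -big_split; apply: eq_bigr => k _ /=.
by rewrite lie_atM // !mxE addrC [T x k j * _]mulrC.
Qed.

Lemma lie_at_mxtrace {a : nat} x v (S : M -> 'M[R]_a) : smooth_mx_at S x ->
  lie_at x v (fun y => \tr (S y)) = \tr (lie_mx x v S).
Proof.
by move=> sS; rewrite lie_at_sum //; apply: eq_bigr => i _; rewrite mxE.
Qed.

(** By cyclicity of the trace all n+1 factors contribute equally. The prefactor of exponent k is
    there for the induction: peeling off one factor raises k by one. *)
Lemma mxtrace_lie_exp {a : nat} x v (S : M -> 'M[R]_a) k n : smooth_mx_at S x ->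
  \tr (S x ^+ k *m lie_mx x v (fun y => S y ^+ n.+1)) =
  n.+1%:R * \tr (S x ^+ (k + n) *m lie_mx x v S).
Proof.
move=> sS; elim: n k => [|n IH] k; first by rewrite addn0 mul1r.
under eq_fun do rewrite exprS.
rewrite lie_mxM //; last exact: smooth_expmx.
rewrite mulmxDr raddfD /= mulmxA mxtrace_mulC !mulmxA -expmxSr.
rewrite IH -[S x ^+ n.+1 *m _]/(S x ^+ n.+1 * _) -exprD addnC addSnnS.
by rewrite [in RHS]mulrSr mulrDl mul1r [RHS]addrC.
Qed.

Lemma lie_at_prod {k : nat} (f : 'I_k -> M -> R) x v :
  (forall i, smooth_fun_at (f i) x) ->
  lie_at x v (fun y => \prod_i f i y) =
  \sum_i \prod_j (if j == i then lie_at x v (f j) else f j x).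
Proof.
elim: k f => [|k IH] f sf.
  by under eq_fun do rewrite big_ord0; rewrite lie_at_cst big_ord0.
under eq_fun do rewrite big_ord_recl.
rewrite lie_atM //; last exact: smooth_fun_at_prod.
rewrite IH // big_ord_recl big_ord_recl eqxx addrC mulrC; congr (_ + _).
rewrite mulr_sumr; apply: eq_bigr => i _.
rewrite big_ord_recl; congr (_ * _).
Qed.

(** Jacobi's formula. Differentiating the Leibniz expansion factor by factor gives the determinants
    in which one row is replaced by its derivative. *)
Lemma lie_at_det {a : nat} x v (S : M -> 'M[R]_a) : smooth_mx_at S x ->
  lie_at x v (fun y => \det (S y)) = \tr (\adj (S x) *m lie_mx x v S).
Proof.
move=> sS; rewrite -sum_det_row_subst.
pose g (t : 'S_a) y : R := (-1) ^+ t * \prod_i S y i (t i).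
have sg t : smooth_fun_at (g t) x.
  apply: smooth_fun_atM; first exact: smooth_fun_at_cst.
  by apply: smooth_fun_at_prod => i; exact: sS.
have lg t : lie_at x v (g t) = \sum_i (-1) ^+ t * \prod_j
    (\matrix_(k, l) (if k == i then lie_mx x v S k l else S x k l)) j (t j).
  rewrite lie_atM; [|exact: smooth_fun_at_cst|by apply: smooth_fun_at_prod => i; exact: sS].
  rewrite lie_at_cst mulr0 addr0 lie_at_prod // mulr_sumr; apply: eq_bigr => i _.
  by congr (_ * _); apply: eq_bigr => j _; rewrite !mxE.
rewrite exchange_big /=.
suff H (s : seq 'S_a) : lie_at x v (fun y => \sum_(t <- s) g t y) =
    \sum_(t <- s) lie_at x v (g t) /\ smooth_fun_at (fun y => \sum_(t <- s) g t y) x.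
  by rewrite [LHS](H _).1; apply: eq_bigr => t _; rewrite lg.
elim: s => [|t s [IH1 IH2]].
  under eq_fun do rewrite big_nil; rewrite lie_at_cst big_nil; split => //.
  exact: smooth_fun_at_cst.
under eq_fun do rewrite big_cons; rewrite lie_atD // big_cons IH1; split => //.
exact: smooth_fun_atD.
Qed.

(** Obtained by differentiating the constant product of S and its inverse. *)
Lemma lie_mx_inv {a : nat} x v (S : M -> 'M[R]_a) : smooth_mx_at S x ->
  (\forall y \near x, S y \in unitmx) ->
  lie_mx x v (fun y => invmx (S y)) = - (invmx (S x) *m lie_mx x v S *m invmx (S x)).
Proof.
move=> sS uS; have ux := nbhs_singleton uS; have sV := smooth_invmx sS uS.
have : lie_mx x v (fun y => S y *m invmx (S y)) = 0.
  rewrite -(lie_mx_cst x v (1%:M : 'M[R]_a)); apply: lie_mx_near_eq.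
  by apply: filterS uS => y uy; rewrite mulmxV.
rewrite lie_mxM // => /eqP; rewrite addrC addr_eq0 => /eqP H.
by rewrite -[LHS](mulKmx ux) H mulmxN mulmxA.
Qed.

Lemma smooth_hmx {a : nat} x (S : M -> 'M[R]_a) k : smooth_mx_at S x ->
  (\forall y \near x, S y \in unitmx) -> smooth_fun_at (fun y => hmx k (S y)) x.
Proof.
move=> sS uS; rewrite /hmx; case: eqP => _.
  apply: smooth_fun_at_ln_norm; first exact: smooth_det.
  by rewrite -unitfE; exact: nbhs_singleton uS.
apply: smooth_fun_atM; first exact: smooth_fun_at_cst.
apply: smooth_mxtrace; case: k => n; apply: smooth_expmx => //; exact: smooth_invmx.
Qed.

(** The normalisation of the hierarchy gives one formula for all k: the factor 1/k cancels the
    exponent, and for k = 0 the logarithm divides Jacobi's formula by the determinant, leaving the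
    inverse matrix. *)
Lemma lie_at_hmx {a : nat} x v (S : M -> 'M[R]_a) k : smooth_mx_at S x ->
  (\forall y \near x, S y \in unitmx) ->
  lie_at x v (fun y => hmx k (S y)) = \tr (mxz (S x) (k - 1) *m lie_mx x v S).
Proof.
move=> sS uS; have ux := nbhs_singleton uS; have sV := smooth_invmx sS uS.
have trexp (T : M -> 'M[R]_a) (c : R) n : smooth_mx_at T x ->
    lie_at x v (fun y => c * \tr (T y ^+ n.+1)) =
    c * n.+1%:R * \tr (T x ^+ n *m lie_mx x v T).
  move=> sT; have sTn := smooth_expmx n.+1 sT.
  rewrite lie_atM; [|exact: smooth_fun_at_cst|exact: smooth_mxtrace].
  rewrite lie_at_cst mulr0 addr0 lie_at_mxtrace // -mulrA; congr (_ * _).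
  by have := mxtrace_lie_exp v 0 n sT; rewrite expr0 mul1mx add0n.
case: k => [[|n]|n]; rewrite /hmx /=.
- rewrite lie_at_ln_norm; [|exact: smooth_det|by rewrite -unitfE].
  by rewrite lie_at_det // expr1 /invmx ux -scalemxAl mxtraceZ.
- rewrite trexp // mulVf ?mul1r; last by rewrite pnatr_eq0.
  by rewrite subn1.
(* Here k = -(n+1). The sign from differentiating the inverse cancels that of 1/k, and its two
   inverse factors lower the exponent from -n to -(n+2) = k - 1. *)
rewrite trexp // lie_mx_inv // mulmxN raddfN /= mulrN NegzE mulrNz.
rewrite invrN !mulNr opprK mulVf ?mul1r; last by rewrite pnatr_eq0.
rewrite addn0 !mulmxA mxtrace_mulC !mulmxA.
by rewrite -expmxS -expmxSr.
Qed.

End MatrixDerivations.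

Lemma near_triv_dom {R : realType} {m r : nat} {M : manifold R m} (E : vbundle M r)
    a x : @triv_dom _ _ _ _ E a x -> \forall y \near x, @triv_dom _ _ _ _ E a y.
Proof. by move=> ax; apply: open_nbhs_nbhs; split=> //; exact: triv_dom_open. Qed.

(** Here B is a frame at a point, D the values of a derivation on it, N and n are the matrices of an
    endomorphism in the fibre and in the trivialisation, and H is the derivative of n. Conjugation
    by B turns N into n and leaves H plus the commutator of B^-1 D with n, whose trace against a
    power of n is zero. *)
Lemma mxtrace_frame {R : realType} {r : nat} (n N B D H : 'M[R]_r) k :
  n \in unitmx -> N \in unitmx -> B \in unitmx -> B *m n = N *m B ->
  \tr (mxz N k *m (D *m n + B *m H - N *m D) *m invmx B) = \tr (mxz n k *m H).
Proof.
move=> un uN uB BN.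
have Bz : invmx B *m mxz N k = mxz n k *m invmx B.
  apply: (can_inj (mulmxK uB)).
  by rewrite -mulmxA -(mxz_intertwine k un uN BN) mulKmx // mulmxKV.
have BN' : invmx B *m N = n *m invmx B.
  by apply: (can_inj (mulmxK uB)); rewrite -mulmxA -BN mulKmx // mulmxKV.
have nz : n *m mxz n k = mxz n k *m n by apply: mxz_intertwine.
rewrite mxtrace_mulC mulmxA Bz -mulmxA (mulmxBr (invmx B)) (mulmxDr (invmx B)).
rewrite mulKmx // [invmx B *m (N *m D)]mulmxA BN'.
rewrite mulmxBr mulmxDr raddfB raddfD /= addrAC.
rewrite [X in X - _](_ : _ = \tr (mxz n k *m (n *m invmx B *m D))) ?subrr ?add0r //.
by rewrite !mulmxA mxtrace_mulC !mulmxA nz.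
Qed.

(** * Sections and endomorphisms in local trivialisations *)

Section Sections.
Context {R : realType} {m : nat} {M : manifold R m} {r : nat}.
Implicit Types (E : vbundle M r) (x y : M) (f g : M -> R).

Local Notation dom E := (@triv_dom _ _ _ _ E).

Lemma smooth_section0 E : smooth_section E (fun=> 0).
Proof.
move=> a x ax; apply: (@smooth_mx_near_eq _ _ _ _ _ (fun=> 0)).
  by apply: nearW => y; rewrite mulmx0.
exact: smooth_mx_at_cst.
Qed.

Lemma smooth_sectionD E (X Y : M -> 'cV[R]_r) : smooth_section E X ->
  smooth_section E Y -> smooth_section E (fun y => X y + Y y).
Proof.
move=> sX sY a x ax; have := smooth_mx_atD (sX a x ax) (sY a x ax).
by apply: smooth_mx_near_eq; apply: nearW => y; rewrite mulmxDr.
Qed.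

Lemma smooth_sectionZ E f (X : M -> 'cV[R]_r) : smooth_fun f ->
  smooth_section E X -> smooth_section E (fun y => f y *: X y).
Proof.
move=> sf sX a x ax; have := smooth_mx_atZ (sf x) (sX a x ax).
by apply: smooth_mx_near_eq; apply: nearW => y; rewrite scalemxAr.
Qed.

Lemma smooth_hom_app {s : nat} E (F : vbundle M s) (S : M -> 'M[R]_(s, r))
    (X : M -> 'cV[R]_r) :
  smooth_hom E F S -> smooth_section E X -> smooth_section F (hom_app S X).
Proof.
move=> sS sX b x bx; have [a ax] := triv_cover E x.
have := smooth_mx_atM (sS a b x ax bx) (sX a x ax).
apply: smooth_mx_near_eq; apply: filterS (near_triv_dom ax) => y ay.
by rewrite -!mulmxA mulKmx ?mulmxA //; exact: triv_unit.
Qed.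

Lemma smooth_hom_local E (N : M -> 'M[R]_r) :
  (forall a x, dom E a x ->
    smooth_mx_at (fun y => triv a y *m N y *m invmx (triv a y)) x) ->
  smooth_hom E E N.
Proof.
move=> sN a b x ax bx; have := smooth_mx_atM (triv_smooth ax bx) (sN a x ax).
apply: smooth_mx_near_eq; apply: filterS (near_triv_dom ax) => y ay.
by rewrite -!mulmxA mulKmx //; exact: triv_unit.
Qed.

Lemma smooth_hom_tr E (N : M -> 'M[R]_r) :
  smooth_hom E E N -> smooth_hom (dual_bundle E) (dual_bundle E) (transpose N).
Proof.
move=> sN a b x ax bx; have := smooth_mx_at_tr (sN b a x bx ax).
apply: smooth_mx_near_eq; apply: filterS (near_triv_dom ax) => y ay.
by rewrite /= /transpose -trmx_inv invmxK !trmx_mul mulmxA.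
Qed.

Lemma smooth_eval_form E (alpha X : M -> 'cV[R]_r) :
  smooth_section (dual_bundle E) alpha -> smooth_section E X ->
  smooth_fun (eval_form alpha X).
Proof.
move=> sa sX x; have [a ax] := triv_cover E x.
have := smooth_mx_atM (smooth_mx_at_tr (sa a x ax)) (sX a x ax) 0 0.
apply: smooth_fun_near_eq; apply: filterS (near_triv_dom ax) => y ay.
rewrite /eval_form /pairing /= trmx_mul trmxK -!mulmxA mulKmx //; exact: triv_unit.
Qed.

Lemma smooth_section_dualK E (X : M -> 'cV[R]_r) :
  smooth_section (dual_bundle (dual_bundle E)) X -> smooth_section E X.
Proof.
move=> sX a x ax; have := sX a x ax.
by apply: smooth_mx_near_eq; apply: nearW => y; rewrite /= -trmx_inv trmxK invmxK.
Qed.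

Definition local_mx E (a : triv_index E) (N : M -> 'M[R]_r) : M -> 'M[R]_r :=
  fun y => triv a y *m N y *m invmx (triv a y).

Lemma smooth_local_mx E a x N : smooth_hom E E N -> dom E a x ->
  smooth_mx_at (local_mx a N) x.
Proof. by move=> sN ax; exact: sN. Qed.

Lemma local_mx_unit E (a : triv_index E) N y : dom E a y -> N y \in unitmx ->
  local_mx a N y \in unitmx.
Proof. by move=> ay uN; rewrite !unitmx_mul uN unitmx_inv triv_unit. Qed.

Lemma triv_local_mx E (a : triv_index E) N y : dom E a y ->
  triv a y *m N y = local_mx a N y *m triv a y.
Proof. by move=> ay; rewrite mulmxKV //; exact: triv_unit. Qed.

Lemma smooth_hom_mxz E N k : smooth_hom E E N -> (forall y, N y \in unitmx) ->
  smooth_hom E E (zpow N k).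
Proof.
move=> sN uN; apply: smooth_hom_local => a x ax.
have sn := smooth_local_mx sN ax.
have un : \forall y \near x, local_mx a N y \in unitmx.
  by apply: filterS (near_triv_dom ax) => y ay; exact: local_mx_unit.
have : smooth_mx_at (fun y => mxz (local_mx a N y) k) x.
  by case: k => n; apply: smooth_expmx => //; exact: smooth_invmx.
apply: smooth_mx_near_eq; apply: filterS (near_triv_dom ax) => y ay.
have ua := triv_unit ay.
rewrite -[zpow N k y]/(mxz (N y) k).
by rewrite (mxz_intertwine k (uN y) (local_mx_unit ay (uN y)) (triv_local_mx _ ay)) mulmxK.
Qed.

(** The entries of [N y] refer to bare fibre coordinates, in which N need not look smooth in y.
    Conjugation invariance passes to [local_mx], whose entries are smooth on the domain. *)
Lemma hfunE E (a : triv_index E) N k y : dom E a y -> N y \in unitmx ->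
  hfun N k y = hmx k (local_mx a N y).
Proof.
move=> ay uN; rewrite -[LHS]/(hmx k (N y)).
by apply: hmx_conj (triv_local_mx N ay) => //; [exact: local_mx_unit|exact: triv_unit].
Qed.

Lemma smooth_hfun E N k : smooth_hom E E N -> (forall y, N y \in unitmx) ->
  smooth_fun (hfun N k).
Proof.
move=> sN uN x; have [a ax] := triv_cover E x.
have : smooth_fun_at (fun y => hmx k (local_mx a N y)) x.
  apply: smooth_hmx; first exact: sN.
  by apply: filterS (near_triv_dom ax) => y ay; exact: local_mx_unit.
by apply: smooth_fun_near_eq; apply: filterS (near_triv_dom ax) => y ay; rewrite -hfunE.
Qed.

(** * Frames *)

(* The sections [frame v] are global: they are cut off by chi, which is
   nonzero at the point of interest x and supported in the domain of a
   trivialisation. *)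
Record cutoff_at E x (a : triv_index E) (chi : M -> R) : Prop := {
  cutoff_dom : dom E a x;
  cutoff_smooth : smooth_fun chi;
  cutoff_neq0 : chi x != 0;
  cutoff_out : forall y, ~ dom E a y -> chi y = 0;
  cutoff_ext : forall f y, (dom E a y -> smooth_fun_at f y) ->
    smooth_fun_at (fun z => chi z * f z) y
}.

Lemma cutoff_exists E x : exists a chi, cutoff_at x (E := E) a chi.
Proof. by have [a [chi [? ? ? ? ?]]] := cutoff E x; exists a, chi; split. Qed.

Definition frame E (a : triv_index E) (chi : M -> R) (v : 'cV[R]_r) : M -> 'cV[R]_r :=
  fun y => chi y *: (invmx (triv a y) *m v).

Lemma frame_smooth E x (a : triv_index E) chi v : cutoff_at x a chi ->
  smooth_section E (frame a chi v).
Proof.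
move=> c b y yb i j.
apply: (@smooth_fun_near_eq _ _ _
  (fun z => chi z * (triv b z *m invmx (triv a z) *m v) i j)).
  by apply: nearW => z; rewrite /frame -scalemxAr mulmxA [RHS]mxE.
apply: (cutoff_ext c) => ay; apply: smooth_mx_atM; last exact: smooth_mx_at_cst.
exact: triv_smooth.
Qed.

(** This reduces identities between covectors at a point to identities on smooth sections. *)
Lemma section_through E x (u : 'cV[R]_r) :
  exists2 X, smooth_section E X & X x = u.
Proof.
have [a [chi c]] := cutoff_exists E x.
exists (frame a chi ((chi x)^-1 *: (triv a x *m u))); first exact: frame_smooth c.
rewrite /frame -scalemxAr scalerA mulfV ?(cutoff_neq0 c) // scale1r mulKmx //.
exact: triv_unit (cutoff_dom c).
Qed.

(** Derivations of sections with symbol w, keeping only the value at x. The instances are Y |->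
    [X, Y](x), with w the anchor of X at x. *)
Record derivation_at E x (w : 'cV[R]_m) (delta : (M -> 'cV[R]_r) -> 'cV[R]_r) : Prop := {
  derivationD : forall Y Z, smooth_section E Y -> smooth_section E Z ->
    delta (fun y => Y y + Z y) = delta Y + delta Z;
  derivationM : forall f Y, smooth_fun f -> smooth_section E Y ->
    delta (fun y => f y *: Y y) = f x *: delta Y + lie_at x w f *: Y x
}.

Lemma derivation0 E x w delta : derivation_at E x w delta -> delta (fun=> 0) = 0.
Proof.
move=> d; have s0 := @smooth_section0 E; have := derivationD d s0 s0.
under eq_fun do rewrite addr0.
by move/eqP; rewrite -subr_eq subrr => /eqP <-.
Qed.

Lemma derivation_sum E x w delta k (Y : 'I_k -> M -> 'cV[R]_r) :
  derivation_at E x w delta -> (forall i, smooth_section E (Y i)) ->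
  delta (fun y => \sum_i Y i y) = \sum_i delta (Y i).
Proof.
move=> d sY.
suff H (s : seq 'I_k) : delta (fun y => \sum_(i <- s) Y i y) = \sum_(i <- s) delta (Y i) /\
    smooth_section E (fun y => \sum_(i <- s) Y i y) by exact: (H _).1.
elim: s => [|i s [IH1 IH2]].
  under eq_fun do rewrite big_nil; rewrite big_nil (derivation0 d); split=> //.
  exact: smooth_section0.
under eq_fun do rewrite big_cons; rewrite (derivationD d) // big_cons IH1.
by split => //; exact: smooth_sectionD.
Qed.

Definition frame_mx E (a : triv_index E) (chi : M -> R)
    (F : (M -> 'cV[R]_r) -> 'cV[R]_r) : 'M[R]_r :=
  \matrix_(i, j) F (frame a chi (delta_mx j 0)) i 0.

Lemma frame_mx_eval E x (a : triv_index E) chi :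
  frame_mx a chi (fun Y => Y x) = chi x *: invmx (triv a x).
Proof.
by apply/matrixP => i j; rewrite mxE /frame -colE !mxE.
Qed.

(** In a frame N Y_j is the sum of the n_kj Y_k, and the product rule separates the derivative of
    the coefficients from that of the frame. *)
Lemma derivation_hom_frame E x (a : triv_index E) chi w delta N :
  cutoff_at x a chi -> derivation_at E x w delta -> smooth_hom E E N ->
  frame_mx a chi (fun Y => delta (hom_app N Y)) =
  frame_mx a chi delta *m local_mx a N x +
  frame_mx a chi (fun Y => Y x) *m lie_mx x w (local_mx a N).
Proof.
move=> c d sN; set n := local_mx a N; have ax := cutoff_dom c.
have sn : smooth_mx_at n x by exact: sN.
have schi := cutoff_smooth c; have chix := cutoff_neq0 c.
pose Y j := frame a chi (delta_mx j 0).
have sY j : smooth_section E (Y j) by exact: frame_smooth c.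
have scn i j : smooth_fun (fun y => chi y * n y i j).
  by move=> y; apply: (cutoff_ext c) => ay; exact: sN.
have NY j y : dom E a y -> N y *m Y j y = \sum_k n y k j *: Y k y.
  move=> ay; rewrite /Y /frame.
  have -> : \sum_k n y k j *: (chi y *: (invmx (triv a y) *m (delta_mx k 0 : 'cV[R]_r))) =
      chi y *: (invmx (triv a y) *m (n y *m (delta_mx j 0 : 'cV[R]_r))).
    rewrite -colE [col j _]matrix_sum_delta mulmx_sumr scaler_sumr.
    apply: eq_bigr => k _.
    by rewrite big_ord1 [col _ _ _ _]mxE -scalemxAr !scalerA mulrC.
  rewrite -scalemxAr; congr (_ *: _); rewrite /n /local_mx !mulmxA.
  by rewrite mulVmx ?mul1mx //; exact: triv_unit.
have key j : delta (hom_app N (Y j)) =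
    \sum_k (n x k j *: delta (Y k) + lie_at x w (fun y => n y k j) *: Y k x).
  have sNY := smooth_hom_app sN (sY j).
  (* The n_kj are smooth only on the domain. Multiplied by chi, the expansion becomes an identity of
     global sections with smooth coefficients, to which delta applies. *)
  have E1 : (fun y => chi y *: hom_app N (Y j) y) =
      (fun y => \sum_k (chi y * n y k j) *: Y k y).
    apply/funext => y; have [ay|nay] := pselect (dom E a y).
      rewrite /hom_app NY // scaler_sumr; apply: eq_bigr => k _.
      by rewrite scalerA.
    rewrite (cutoff_out c) // scale0r big1 // => k _.
    by rewrite mul0r scale0r.
  have := derivationM d schi sNY; rewrite E1 (derivation_sum d); last first.
    by move=> k; exact: smooth_sectionZ.
  have E2 k : delta (fun y => (chi y * n y k j) *: Y k y) =
      chi x *: (n x k j *: delta (Y k) + lie_at x w (fun y => n y k j) *: Y k x) +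
      lie_at x w chi *: (n x k j *: Y k x).
    rewrite (derivationM d) ?lie_atM //.
    by rewrite scalerDl scalerDr !scalerA addrA [n x k j * _]mulrC.
  under eq_bigr do rewrite E2.
  (* The terms with the derivative of chi agree on both sides and cancel; then chi x, which is
     nonzero, is divided out. *)
  rewrite big_split /= -!scaler_sumr -NY // => /addIr.
  by move/(scalerI chix) <-.
apply/matrixP => i j; rewrite !mxE key summxE -big_split; apply: eq_bigr => k _ /=.
by rewrite !mxE mulrC [in X in _ + X]mulrC.
Qed.

(** The matrix in the middle lists the values on the frame of K = [delta, N], and the inverse frame
    matrix makes an endomorphism of the fibre of it: the right side is the trace of N^(k-1) K. *)
Lemma lie_at_hfun E x (a : triv_index E) chi w delta N k :
  cutoff_at x a chi -> derivation_at E x w delta -> smooth_hom E E N ->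
  (forall y, N y \in unitmx) ->
  lie_at x w (hfun N k) =
  \tr (mxz (N x) (k - 1) *m
    frame_mx a chi (fun Y => delta (hom_app N Y) - N x *m delta Y) *m
    invmx (frame_mx a chi (fun Y => Y x))).
Proof.
move=> c d sN uN; have ax := cutoff_dom c; have ua := triv_unit ax.
set n := local_mx a N; set B := frame_mx a chi (fun Y => Y x).
have un : \forall y \near x, n y \in unitmx.
  by apply: filterS (near_triv_dom ax) => y ay; exact: local_mx_unit.
have unx := nbhs_singleton un.
rewrite (@lie_at_near_eq _ _ _ _ _ _ (fun y => hmx k (n y))); last first.
  by apply: filterS (near_triv_dom ax) => y ay; rewrite -hfunE.
rewrite lie_at_hmx //; last exact: sN.
have uB : B \in unitmx.
  by rewrite /B frame_mx_eval unitmxZ ?unitmx_inv // unitfE (cutoff_neq0 c).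
have BN : B *m n x = N x *m B.
  rewrite /B frame_mx_eval -scalemxAl -scalemxAr; congr (_ *: _).
  by rewrite /n /local_mx !mulmxA mulVmx // mul1mx.
have -> : frame_mx a chi (fun Y => delta (hom_app N Y) - N x *m delta Y) =
    frame_mx a chi (fun Y => delta (hom_app N Y)) - N x *m frame_mx a chi delta.
  apply/matrixP => i j; rewrite !mxE; congr (_ - _).
  by apply: eq_bigr => l _; rewrite mxE.
rewrite (derivation_hom_frame c d sN) -/n -/B.
by rewrite (mxtrace_frame _ _ _ unx (uN x) uB BN).
Qed.

End Sections.

(** * Multivectors *)

Section Alternating.
Context {R : realType} {r : nat}.
Implicit Types (w : multivector R r) (v : nat -> 'cV[R]_r).

Lemma upd_id v i : upd v i (v i) = v.
Proof. by apply/funext => k; rewrite /upd; case: eqP => // ->. Qed.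

Lemma updC v i j u u' : i != j -> upd (upd v i u) j u' = upd (upd v j u') i u.
Proof.
move=> ij; apply/funext => k; rewrite /upd; case: eqP => // ->.
by rewrite eq_sym (negbTE ij).
Qed.

Lemma alternatingD p w v i u u' : is_alternating p w -> (i < p)%N ->
  w (upd v i (u + u')) = w (upd v i u) + w (upd v i u').
Proof. by move=> [_ lin _] ip; have := lin i v 1 u u' ip; rewrite scale1r mul1r. Qed.

Lemma alternating0 p w v i : is_alternating p w -> (i < p)%N -> w (upd v i 0) = 0.
Proof.
move=> alt ip; have := alternatingD v 0 0 alt ip; rewrite addr0 => /eqP.
by rewrite -subr_eq subrr => /eqP.
Qed.

Lemma alternating_sum p w v i k (a : 'I_k -> R) (u : 'I_k -> 'cV[R]_r) :
  is_alternating p w -> (i < p)%N ->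
  w (upd v i (\sum_j a j *: u j)) = \sum_j a j * w (upd v i (u j)).
Proof.
move=> alt ip; suff H (s : seq 'I_k) : w (upd v i (\sum_(j <- s) a j *: u j)) =
  \sum_(j <- s) a j * w (upd v i (u j)) by exact: H.
elim: s => [|j s IH]; first by rewrite !big_nil (alternating0 _ alt).
by case: (alt) => _ lin _; rewrite !big_cons lin // IH.
Qed.

Lemma alternating_swap p w v i j : is_alternating p w -> (i < j < p)%N ->
  w (upd (upd v i (v j)) j (v i)) = - w v.
Proof.
move=> alt ijp; have /andP[ij jp] := ijp; have ip := ltn_trans ij jp.
have nij : i != j by rewrite neq_ltn ij.
have eqz u : w (upd (upd v i u) j u) = 0.
  by case: alt => _ _; apply; first exact: ijp; rewrite /upd eqxx (negbTE nij) eqxx.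
(* Polarisation: the form is expanded with v_i + v_j in both places. *)
have := eqz (v i + v j).
rewrite (alternatingD _ _ _ alt jp) !(updC _ _ _ nij) !(alternatingD _ _ _ alt ip).
rewrite -!(updC _ _ _ nij) !eqz add0r addr0 upd_id upd_id => /eqP.
by rewrite addr_eq0 => /eqP ->.
Qed.

Lemma perm_natE n (s : 'S_n) (i : 'I_n) : perm_nat s i = s i.
Proof. by rewrite /perm_nat valK. Qed.

Lemma perm_natM n (s t : 'S_n) i : perm_nat (s * t)%g i = perm_nat t (perm_nat s i).
Proof.
rewrite /perm_nat; case: insubP => [k _ ki|ni]; first by rewrite valK permM.
by case: insubP => // k kn ki; rewrite -ki ltn_ord in ni.
Qed.

Lemma alternating_perm p w (s : 'S_p) v : is_alternating p w ->
  w (fun i => v (perm_nat s i)) = (-1) ^+ s * w v.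
Proof.
move=> alt; have [ts -> dts] := prod_tpermP s.
elim: ts dts v => [|[a b] ts IH] /= dts v.
  rewrite big_nil odd_perm1 mul1r; case: (alt) => ext _ _; apply: ext => i ip.
  by rewrite (perm_natE _ (Ordinal ip)) perm1.
move: dts => /andP[/= ab dts]; rewrite big_cons odd_permM odd_tperm ab signr_addb.
rewrite expr1 mulN1r mulNr -IH //; set t := (\prod_(_ <- ts) _)%g.
pose v' i := v (perm_nat t i).
rewrite (_ : (fun i => _) = fun i => v' (perm_nat (tperm a b) i)); last first.
  by apply/funext => i; rewrite perm_natM.
wlog : a b ab / (a < b)%N => [H|lt_ab].
  move: ab; rewrite /= -val_eqE neq_ltn => /orP[] lt.
    by apply: H => //; rewrite -val_eqE neq_ltn lt.
  by rewrite tpermC; apply: H => //; rewrite /dpair /= -val_eqE neq_ltn lt.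
rewrite -(alternating_swap v' alt (i := a) (j := b)) ?lt_ab ?ltn_ord //.
case: (alt) => ext _ _; apply: ext => i ip; rewrite (perm_natE _ (Ordinal ip)) /upd.
case: tpermP => [/(congr1 val) /= -> |/(congr1 val) /= ->|].
- by rewrite eqxx; case: eqP => // ->.
- by rewrite eqxx.
by move=> /eqP; rewrite -val_eqE /= => /negbTE -> /eqP; rewrite -val_eqE /= => /negbTE ->.
Qed.

(** The standard basis indexed by nat, so that it can serve as argument of a multivector; it is 0
    for k >= r. *)
Definition std_vec (k : nat) : 'cV[R]_r := \col_j (val j == k)%:R.

Lemma std_vecE (j : 'I_r) : std_vec j = delta_mx j 0.
Proof. by apply/matrixP => i l; rewrite !mxE ord1 eqxx andbT. Qed.

Definition args_mx v : 'M[R]_r := \matrix_(i, j) v i j 0.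

Lemma args_mx_std_vec : args_mx std_vec = 1%:M.
Proof. by apply/matrixP => i j; rewrite !mxE eq_sym. Qed.

(** Induction on the number k of leading arguments that are still arbitrary. For k = 0 all arguments
    are basis vectors: either two coincide or they are a permutation of the basis. *)
Lemma alternating_std_vec0 w : is_alternating r w -> w std_vec = 0 -> forall v, w v = 0.
Proof.
move=> alt w0; have [ext lin alt0] := alt.
suff H k : forall v,
    (forall i : 'I_r, (k <= i)%N -> exists j : 'I_r, v i = std_vec j) -> w v = 0.
  by move=> v; apply: (H r) => i; rewrite leqNgt ltn_ord.
elim: k => [|k IH] v vb.
  have /choice[f vf] : forall i : 'I_r, exists j : 'I_r, v i = std_vec j.
    by move=> i; exact: vb.
  have [/injectiveP fi|/injectivePn[i [j ij fij]]] := boolP (injectiveb f).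
    rewrite -(ext (fun i => std_vec (perm_nat (perm fi) i))); last first.
      by move=> i ir; rewrite (perm_natE _ (Ordinal ir)) permE -vf.
    by rewrite (alternating_perm _ _ alt) w0 mulr0.
  move: ij; rewrite -val_eqE neq_ltn => /orP[] lt.
    by apply: (alt0 i j); rewrite ?lt ?ltn_ord // !vf fij.
  by apply: (alt0 j i); rewrite ?lt ?ltn_ord // !vf fij.
have [kr|rk] := ltnP k r; last first.
  by apply: IH => i ki; have := leq_trans rk ki; rewrite leqNgt ltn_ord.
(* Argument k is expanded in the basis; each term falls under the induction hypothesis. *)
have -> : v = upd v k (\sum_(j < r) v k j 0 *: std_vec j).
  rewrite -[LHS](upd_id v k); congr (upd _ _ _).
  rewrite [LHS]matrix_sum_delta; apply: eq_bigr => j _; rewrite big_ord1 std_vecE.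
  by congr (v k j _ *: delta_mx j _); rewrite ord1.
rewrite (alternating_sum _ _ _ alt kr) big1 // => j _; rewrite IH ?mulr0 // => i ki.
rewrite /upd; case: eqP => [_|/eqP nik]; first by exists j.
by apply: vb; rewrite ltn_neqAle eq_sym nik.
Qed.

(** The scalar c is [w std_vec] when a top form is compared with the determinant, and 1 for a
    difference of two brackets. *)
Lemma alternatingB p w w' c : is_alternating p w -> is_alternating p w' ->
  is_alternating p (fun v => w v - w' v * c).
Proof.
move=> [e l a] [e' l' a']; split.
- by move=> v v' vv'; rewrite (e _ _ vv') (e' _ _ vv').
- move=> i v b u u' ip; rewrite l // l' //; ring.
by move=> i j v ijp vij; rewrite (a _ _ _ ijp vij) (a' _ _ _ ijp vij) mul0r subrr.
Qed.

Lemma det_alternating k (Y : 'M[R]_(r, k)) :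
  is_alternating k (fun v => \det (\matrix_(i < k, j < k) pairing (v i) (col j Y))).
Proof.
split.
- move=> v v' vv'; congr determinant; apply/matrixP => i j; rewrite !mxE vv' //.
- move=> i v a u u' ik; pose i0 := Ordinal ik.
  rewrite -[X in _ = _ + X]mul1r.
  apply: (determinant_multilinear (i0 := i0)).
  + apply/rowP => j; rewrite !mxE /upd eqxx mul1r /pairing.
    by rewrite linearD linearZ /= mulmxDl -scalemxAl !mxE.
  + apply/matrixP => k' j; rewrite !mxE /upd.
    by have := neq_lift i0 k'; rewrite -val_eqE eq_sym /= => /negbTE ->.
  + apply/matrixP => k' j; rewrite !mxE /upd.
    by have := neq_lift i0 k'; rewrite -val_eqE eq_sym /= => /negbTE ->.
move=> i j v /andP[ij jk] vij; pose i0 := Ordinal (ltn_trans ij jk); pose j0 := Ordinal jk.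
apply: (determinant_alternate (i1 := i0) (i2 := j0)).
  by rewrite -val_eqE neq_ltn /= ij.
by move=> l; rewrite !mxE /= vij.
Qed.

Lemma alternating_top w v : is_alternating r w -> w v = \det (args_mx v) * w std_vec.
Proof.
move=> alt; have detalt : is_alternating r (fun v => \det (args_mx v)).
  have := det_alternating (1%:M : 'M[R]_r).
  rewrite (_ : (fun v => _) = (fun v => \det (args_mx v))) //.
  apply/funext => v'; congr determinant; apply/matrixP => i j; rewrite !mxE.
  by rewrite col1 /pairing -colE !mxE.
have := alternating_std_vec0 (alternatingB (w std_vec) alt detalt).
by rewrite args_mx_std_vec det1 mul1r subrr => /(_ erefl v) /eqP; rewrite subr_eq0 => /eqP.
Qed.

End Alternating.

(** * Wedge products and derivations of multivectors *)

Section Wedge.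
Context {R : realType} {m : nat} {M : manifold R m} {r : nat}.
Implicit Types (P Q S : M -> multivector R r) (Y : nat -> M -> 'cV[R]_r) (x : M).

Lemma mv_wedge_sumr p q P k (Q : 'I_k -> M -> multivector R r) :
  mv_wedge p q P (fun x v => \sum_i Q i x v) =
  (fun x v => \sum_i mv_wedge p q P (Q i) x v).
Proof.
apply/funext => x; apply/funext => v; rewrite /mv_wedge -mulr_sumr; congr (_ * _).
by rewrite exchange_big; apply: eq_bigr => s _; rewrite mulr_sumr.
Qed.

Lemma mv_wedgeBl p q P P' Q :
  mv_wedge p q (fun x v => P x v - P' x v) Q =
  (fun x v => mv_wedge p q P Q x v - mv_wedge p q P' Q x v).
Proof.
apply/funext => x; apply/funext => v; rewrite /mv_wedge -mulrBr; congr (_ * _).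
by rewrite -sumrB; apply: eq_bigr => s _; rewrite mulrBr mulrBl.
Qed.

Lemma mv_wedgeBr p q P Q Q' :
  mv_wedge p q P (fun x v => Q x v - Q' x v) =
  (fun x v => mv_wedge p q P Q x v - mv_wedge p q P Q' x v).
Proof.
apply/funext => x; apply/funext => v; rewrite /mv_wedge -mulrBr; congr (_ * _).
by rewrite -sumrB; apply: eq_bigr => s _; rewrite mulrBr.
Qed.

Lemma mv_wedge_fun q f Q x v : is_alternating q (Q x) ->
  mv_wedge 0 q (mv_fun f) Q x v = f x * Q x v.
Proof.
move=> alt; rewrite /mv_wedge fact0 mul1n.
rewrite (eq_bigr (fun=> f x * Q x v)) => [|s _].
  by rewrite sumr_const card_Sn -[X in _ * X]mulr_natl mulKf // pnatr_eq0 -lt0n fact_gt0.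
by rewrite (alternating_perm s v alt) /mv_fun mulrACA -signr_addb addbb mul1r.
Qed.

(** The k-vector Y_0 ^ ... ^ Y_(k-1). *)
Definition wedge_sections k Y : M -> multivector R r := fun x v =>
  \det (\matrix_(i < k, j < k) pairing (v i) (Y j x)).

Definition scons (Z : M -> 'cV[R]_r) Y : nat -> M -> 'cV[R]_r :=
  fun i => if i is i'.+1 then Y i' else Z.

(** Expanding the k by k determinant over permutations t turns the wedge into a double sum; each of
    the k! values of t gives the full determinant, and k! cancels the normalisation of the wedge. *)
Lemma wedge_sections_cons k Z Y :
  mv_wedge 1 k (mv_sec Z) (wedge_sections k Y) = wedge_sections k.+1 (scons Z Y).
Proof.
apply/funext => x; apply/funext => v; rewrite /mv_wedge mul1n.
pose G : 'M[R]_k.+1 := \matrix_(i, j) pairing (v i) (scons Z Y j x).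
have minor (s : 'S_k.+1) : wedge_sections k Y x (fun j => v (perm_nat s (1 + j)%N)) =
    \sum_(t : 'S_k) (-1) ^+ t * \prod_j G (s (lift ord0 (t j))) (lift ord0 j).
  rewrite /wedge_sections -det_tr; apply: eq_bigr => t _; congr (_ * _).
  apply: eq_bigr => j _; rewrite !mxE; congr (pairing (v _) (_ x)).
  by rewrite -(perm_natE s) lift0.
have -> : \sum_(s : 'S_(1 + k)) (-1) ^+ s * mv_sec Z x (fun i => v (perm_nat s i)) *
      wedge_sections k Y x (fun j => v (perm_nat s (1 + j)%N)) =
    \sum_(t : 'S_k) \sum_(s : 'S_k.+1) (-1) ^+ (lift_perm ord0 ord0 t * s)%g *
      \prod_j G ((lift_perm ord0 ord0 t * s)%g j) j.
  rewrite exchange_big /=; apply: eq_bigr => s _; rewrite minor mulr_sumr.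
  apply: eq_bigr => t _; rewrite odd_permM odd_lift_perm /= signr_addb.
  rewrite big_ord_recl permM lift_perm_id mulrACA; congr (_ * (_ * _)).
  - exact: mulrC.
  - by rewrite mxE /mv_sec -(perm_natE s).
  by apply: eq_bigr => j _; rewrite permM lift_perm_lift.
(* Translation by the lift of t permutes the summation range, so the inner sum is independent of
   t. *)
under eq_bigr => t _ do rewrite -(reindex_inj (mulgI (lift_perm ord0 ord0 t)) (P := xpredT)
  (F := fun s : 'S_k.+1 => (-1) ^+ s * \prod_j G (s j) j)).
have -> : \sum_(s : 'S_k.+1) (-1) ^+ s * \prod_j G (s j) j = \det G.
  rewrite -det_tr; apply: eq_bigr => s _; congr (_ * _).
  by apply: eq_bigr => j _; rewrite [RHS]mxE.
by rewrite sumr_const card_Sn -[X in _ * X]mulr_natl mulKf // pnatr_eq0 -lt0n fact_gt0.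
Qed.

Lemma is_multivector_fun (E : vbundle M r) f : smooth_fun f ->
  is_multivector E 0 (mv_fun f).
Proof.
move=> sf; split=> // x; split=> // i j v.
by rewrite ltn0 andbF.
Qed.

Lemma is_multivector_wedge_sections (E : vbundle M r) k Y :
  (forall i, smooth_section E (Y i)) -> is_multivector E k (wedge_sections k Y).
Proof.
move=> sY; split=> [x|alpha sa x].
  have := det_alternating (\matrix_(i < r, j < k) Y j x i 0).
  rewrite (_ : (fun v => _) = wedge_sections k Y x) //.
  apply/funext => v; congr determinant; apply/matrixP => i j; rewrite !mxE.
  by congr pairing; apply/matrixP => a b; rewrite !mxE ord1.
apply: smooth_det => i j.
have H : smooth_fun_at _ x := smooth_eval_form (sa i) (sY j) (x := x); move: H.
by apply: smooth_fun_near_eq; apply: nearW => y; rewrite mxE.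
Qed.

Lemma is_multivector_sec (E : vbundle M r) Z :
  smooth_section E Z -> is_multivector E 1 (mv_sec Z).
Proof.
move=> sZ; have := @is_multivector_wedge_sections E 1 (fun=> Z) (fun=> sZ).
congr (is_multivector _ _ _); apply/funext => x; apply/funext => v.
by rewrite /wedge_sections det_mx11 mxE.
Qed.

(* Only the values of D on multivectors of matching degree are constrained. *)
Record mv_derivation (E : vbundle M r)
    (D : nat -> (M -> multivector R r) -> M -> multivector R r)
    (T : (M -> 'cV[R]_r) -> M -> 'cV[R]_r) : Prop := {
  mv_derivation_fun : forall f, smooth_fun f -> D 0%N (mv_fun f) = mv_fun (fun=> 0);
  mv_derivation_sec : forall (Y : M -> 'cV[R]_r), smooth_section E Y ->
    D 1%N (mv_sec Y) = mv_sec (T Y);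
  mv_derivationM : forall q s Q S, is_multivector E q Q -> is_multivector E s S ->
    D (q + s)%N (mv_wedge q s Q S) =
    (fun x v => mv_wedge q s (D q Q) S x v + mv_wedge q s Q (D s S) x v);
  mv_derivation_alternating : forall q Q x, is_multivector E q Q ->
    is_alternating q (D q Q x)
}.

(** Multiplication by f is the wedge with a 0-vector, and D annihilates functions. *)
Lemma mv_derivationZ E D T f q Q : mv_derivation E D T -> smooth_fun f ->
  is_multivector E q Q ->
  D q (fun x v => f x * Q x v) = (fun x v => f x * D q Q x v).
Proof.
move=> d sf mQ.
have -> : (fun x v => f x * Q x v) = mv_wedge 0 q (mv_fun f) Q.
  by apply/funext => x; apply/funext => v; rewrite mv_wedge_fun //; exact: mQ.1.
rewrite (mv_derivationM d (is_multivector_fun E sf) mQ) (mv_derivation_fun d) //.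
apply/funext => x; apply/funext => v; rewrite !mv_wedge_fun ?mul0r ?add0r //.
  exact: (mv_derivation_alternating d).
exact: mQ.1.
Qed.

Lemma mv_derivation_wedge E D T k Y : mv_derivation E D T ->
  (forall i, smooth_section E (Y i)) ->
  D k (wedge_sections k Y) = (fun x v => \sum_(i < k)
    wedge_sections k (fun j => if j == i then T (Y j) else Y j) x v).
Proof.
move=> d; elim: k Y => [|k IH] Y sY.
  have -> : wedge_sections 0 Y = mv_fun (fun=> 1).
    by apply/funext => x; apply/funext => v; rewrite /wedge_sections det_mx00.
  rewrite (mv_derivation_fun d); last by move=> x; exact: smooth_fun_at_cst.
  by apply/funext => x; apply/funext => v; rewrite big_ord0.
pose Y' i := Y i.+1; have sY' i : smooth_section E (Y' i) by exact: sY.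
have YE : Y = scons (Y 0%N) Y' by apply/funext => -[].
rewrite {1}YE -wedge_sections_cons -[k.+1]/(1 + k)%N.
rewrite (mv_derivationM d (is_multivector_sec (sY 0%N))
  (is_multivector_wedge_sections k sY')).
rewrite (mv_derivation_sec d) // IH // mv_wedge_sumr.
apply/funext => x; apply/funext => v; rewrite big_ord_recl; congr (_ + _).
  rewrite wedge_sections_cons; congr (wedge_sections _ _ x v).
  by apply/funext => -[].
apply: eq_bigr => i _; rewrite wedge_sections_cons; congr (wedge_sections _ _ x v).
by apply/funext => -[].
Qed.

End Wedge.

(** * Derivations in top degree *)

Section TopDegree.
Context {R : realType} {m : nat} {M : manifold R m} {r : nat}.
Implicit Types (E : vbundle M r) (x y : M).

Lemma cutoff_at_dual E x (a : triv_index E) chi :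
  cutoff_at x a chi -> cutoff_at x (E := dual_bundle E) a chi.
Proof. by move=> [? ? ? ? ?]; split. Qed.

Lemma wedge_sections_top E (a : triv_index E) chi y v :
  wedge_sections r (fun j => frame a chi (std_vec j)) y v =
  \det (args_mx v) * \det (frame_mx a chi (fun Y => Y y)).
Proof.
rewrite -det_mulmx; congr determinant; apply/matrixP => i j.
rewrite [LHS]mxE /pairing [LHS]mxE [RHS]mxE.
by apply: eq_bigr => k _; rewrite !mxE std_vecE.
Qed.

(** A function-linear derivation acts on the top power by its trace. Up to the factor g = chi^(2r),
    nonzero at x, nu is a function multiple of the wedge of a global cut-off frame, on which D
    replaces one section at a time. *)
Lemma mv_derivation_top E x (a : triv_index E) chi D T nu v :
  cutoff_at x a chi -> mv_derivation E D T -> is_multivector E r nu ->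
  D r nu x v = \tr (frame_mx a chi (fun Y => T Y x) *m
    invmx (frame_mx a chi (fun Y => Y x))) * nu x v.
Proof.
move=> c d mnu; have cd := cutoff_at_dual c.
pose Y j := frame a chi (std_vec j).
have sY j : smooth_section E (Y j) by exact: frame_smooth c.
pose theta j := frame (E := dual_bundle E) a chi (std_vec j).
have stheta j : smooth_section (dual_bundle E) (theta j) by exact: frame_smooth cd.
pose f y := nu y (theta^~ y); have sf : smooth_fun f by exact: mnu.2.
pose g y := chi y ^+ r * chi y ^+ r.
have sg : smooth_fun g.
  have H n : smooth_fun (fun y => chi y ^+ n).
    elim: n => [|n IH] y; first by under eq_fun do rewrite expr0; exact: smooth_fun_at_cst.
    have schi : smooth_fun_at chi y by move: y; exact: cutoff_smooth c.
    by under eq_fun do rewrite exprS; have H := smooth_fun_atM schi (IH y); exact: H.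
  by move=> y; apply: smooth_fun_atM; exact: H.
(* theta_0, ..., theta_(r-1) evaluates Y_0 ^ ... ^ Y_(r-1) to chi^(2 r) *)
have main : (fun y v => g y * nu y v) = (fun y v => f y * wedge_sections r Y y v).
  apply/funext => y; apply/funext => v'.
  rewrite /f (alternating_top v' (mnu.1 y)) (alternating_top (theta^~ y) (mnu.1 y)).
  rewrite wedge_sections_top.
  have -> : args_mx (theta^~ y) = chi y *: triv a y.
    apply/matrixP => i j; rewrite [LHS]mxE /theta /frame std_vecE -colE /=.
    by rewrite -trmx_inv invmxK !mxE.
  rewrite frame_mx_eval !detZ /g.
  set dV := \det (args_mx v'); set b := nu y std_vec.
  have [ay|nay] := pselect (triv_dom a y).
    have da : \det (triv a y) \is a GRing.unit by exact: triv_unit ay.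
    rewrite det_inv -[in LHS](mulr1 (chi y ^+ r * _)) -(divrr da); ring.
  (* Off the domain chi is 0 and both sides vanish, except for r = 0, where 0 ^+ 0 = 1 and all
     determinants are 1. *)
  rewrite (cutoff_out c nay); case: (posnP r) => [r0|r_gt0].
    have d1 (A : 'M[R]_r) : \det A = 1.
      by move: A; rewrite r0 => A; rewrite det_mx00.
    have -> : 0 ^+ r = 1 :> R by rewrite r0.
    by rewrite !d1 !mul1r mulr1 mulrC.
  by rewrite expr0n eqn0Ngt r_gt0 /=; ring.
have uB : frame_mx a chi (fun Y => Y x) \in unitmx.
  rewrite frame_mx_eval unitmxZ ?unitmx_inv ?(triv_unit (cutoff_dom c)) //.
  by rewrite unitfE (cutoff_neq0 c).
have gx : g x != 0 by rewrite mulf_neq0 ?expf_neq0 ?(cutoff_neq0 c).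
have altD := mv_derivation_alternating d (Q := nu) x mnu.
rewrite (alternating_top v altD) (alternating_top v (mnu.1 x)) mulrCA; congr (_ * _).
apply: (mulfI gx).
have := mv_derivationZ d sg mnu; rewrite main.
rewrite (mv_derivationZ d sf (is_multivector_wedge_sections r sY)).
rewrite (mv_derivation_wedge r d sY) => /(congr1 (fun w => w x std_vec)) /= <-.
rewrite mulrCA [g x * _](congr1 (fun w => w x std_vec) main) /=.
rewrite wedge_sections_top args_mx_std_vec det1 mul1r mulrCA; congr (_ * _).
set B := frame_mx a chi (fun Y => Y x); set H := frame_mx a chi _.
(* Frame sections are columns of B, while [sum_det_row_subst] replaces rows; hence the
   transposes. *)
transitivity (\tr (\adj B^T *m H^T)).
  rewrite -sum_det_row_subst; apply: eq_bigr => i _; rewrite -det_tr.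
  congr determinant; apply/matrixP => k l; rewrite !mxE.
  rewrite /pairing (std_vecE k) trmx_delta -rowE [row _ _ _ _]mxE /Y std_vecE.
  by rewrite -val_eqE /=; case: eqP => // _; rewrite /frame !mxE.
rewrite -trmx_adj -trmx_mul mxtrace_tr /invmx uB -scalemxAr mxtraceZ.
by rewrite [RHS]mulrAC mulVf ?mul1r // -unitfE.
Qed.


End TopDegree.

(** * The hierarchy *)

Section Pairing.
Context {R : realType} {r : nat}.

Lemma pairing_trmx {s : nat} (A : 'M[R]_(s, r)) alpha u :
  pairing (A^T *m alpha) u = pairing alpha (A *m u).
Proof. by rewrite /pairing trmx_mul trmxK mulmxA. Qed.

Lemma pairingC (alpha u : 'cV[R]_r) : pairing alpha u = pairing u alpha.
Proof.
by rewrite /pairing -[in LHS](trmxK u) -trmx_mul mxE.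
Qed.

Lemma pairingBl (alpha beta u : 'cV[R]_r) :
  pairing (alpha - beta) u = pairing alpha u - pairing beta u.
Proof. by rewrite /pairing linearB /= mulmxBl mxE [X in _ + X]mxE. Qed.

Lemma pairingDr (alpha u u' : 'cV[R]_r) :
  pairing alpha (u + u') = pairing alpha u + pairing alpha u'.
Proof. by rewrite /pairing mulmxDr [LHS]mxE. Qed.

Lemma pairingZr (alpha u : 'cV[R]_r) (a : R) :
  pairing alpha (a *: u) = a * pairing alpha u.
Proof. by rewrite /pairing -scalemxAr [LHS]mxE. Qed.

Lemma pairing_injl (alpha beta : 'cV[R]_r) :
  (forall u, pairing alpha u = pairing beta u) -> alpha = beta.
Proof.
move=> ab; apply/matrixP => i j; rewrite ord1; have := ab (delta_mx i 0).
by rewrite /pairing -!colE !mxE.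
Qed.

Lemma pairing_injr (u u' : 'cV[R]_r) :
  (forall alpha, pairing alpha u = pairing alpha u') -> u = u'.
Proof.
move=> uu'; apply/matrixP => i j; rewrite ord1; have := uu' (delta_mx i 0).
by rewrite /pairing trmx_delta -!rowE !mxE.
Qed.

End Pairing.

(** * Differentials of the hierarchy functions and the modular vector field *)

Section Hierarchy.
Context {R : realType} {m r : nat} {M : manifold R m}.
Implicit Types (E : vbundle M r) (L : algebroid M r) (N : M -> 'M[R]_r) (x : M).

Lemma hfun_transpose N k : hfun (transpose N) k = hfun N k.
Proof.
apply/funext => x; rewrite -[LHS]/(hmx k (N x)^T) -[RHS]/(hmx k (N x)).
by rewrite /hmx det_tr mxz_tr mxtrace_tr.
Qed.

Lemma lie_algebroid_derivation E L X x : is_lie_algebroid E L -> smooth_section E X ->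
  derivation_at E x (anchor L x *m X x) (fun Y => bracket L X Y x).
Proof.
move=> LE sX; split=> [Y Z sY sZ|f Y sf sY].
  have := bracket_linear LE 1 sX sY sZ => /(congr1 (fun F => F x)).
  by rewrite scale1r; under eq_fun do rewrite scale1r.
by rewrite (bracket_leibniz LE sX sY sf).
Qed.

Lemma nijenhuis_diff_hfun E L N k x : is_lie_algebroid E L -> is_nijenhuis E L N ->
  (forall y, N y \in unitmx) ->
  (N x)^T *m diff_fun L (hfun N k) x = diff_fun L (hfun N (k + 1)) x.
Proof.
move=> LE [sN torsion] uN; apply: pairing_injl => u.
have [X sX <-] := section_through E x u.
have [a [chi c]] := cutoff_exists E x.
have sNX := smooth_hom_app sN sX.
have d := lie_algebroid_derivation x LE sX.
have dN := lie_algebroid_derivation x LE sNX.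
rewrite /diff_fun !pairing_trmx.
rewrite -[LHS]/(lie_at x (anchor L x *m hom_app N X x) (hfun N k)).
rewrite -[RHS]/(lie_at x (anchor L x *m X x) (hfun N (k + 1))).
rewrite (lie_at_hfun k c dN sN uN) (lie_at_hfun (k + 1) c d sN uN) addrK.
(* With vanishing torsion [NX, NY] - N [NX, Y] equals N ([X, NY] - N [X, Y]), the terms N [NX, Y]
   cancelling. The extra N raises the exponent from k - 1 to k. *)
have -> : frame_mx a chi (fun Y => bracket L (hom_app N X) (hom_app N Y) x -
      N x *m bracket L (hom_app N X) Y x) =
    N x *m frame_mx a chi (fun Y => bracket L X (hom_app N Y) x - N x *m bracket L X Y x).
  apply/matrixP => i j; rewrite [LHS]mxE torsion //; last exact: frame_smooth c.
  rewrite {1}/hom_app /= -mulmxBr addrAC [_ + bracket L X _ x]addrC addrK.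
  by rewrite !mxE; apply: eq_bigr => l _; rewrite [in RHS]mxE.
have Nz := mxz_intertwine (k - 1) (uN x) (uN x) (erefl (N x *m N x)).
have -> : mxz (N x) k = N x *m mxz (N x) (k - 1) by rewrite -mxzS // subrK.
by rewrite !mulmxA -Nz.
Qed.

(** The rules for the bracket are read off from the Schouten bracket in degrees 0 and 1. For the
    dual algebroid that bracket is supplied by [is_modular_form]. *)
Lemma schouten_derivation E L sb X x : is_schouten E L sb -> smooth_section E X ->
  derivation_at E x (anchor L x *m X x) (fun Y => bracket L X Y x).
Proof.
move=> S sX; have mX := is_multivector_sec sX.
split=> [Y Z sY sZ|f Y sf sY]; apply: pairing_injr => alpha.
  have mY := is_multivector_sec sY; have mZ := is_multivector_sec sZ.
  have := schouten_linear S 1 mX mY mZ.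
  rewrite (_ : (fun y v => _) = mv_sec (fun y => Y y + Z y)); last first.
    by apply/funext => y; apply/funext => v; rewrite /mv_sec pairingDr mul1r.
  rewrite !(schouten_sec_sec S) //; last exact: smooth_sectionD.
  move=> /(congr1 (fun F => F x (fun=> alpha))); rewrite /mv_sec => ->.
  by rewrite mul1r pairingDr.
have mY := is_multivector_sec sY; have mf := is_multivector_fun E sf.
have := schouten_leibniz S mX mf mY.
have fE q (g : M -> R) Q : (forall y, is_alternating q (Q y)) ->
    mv_wedge 0 q (mv_fun g) Q = (fun y v => g y * Q y v).
  by move=> alt; apply/funext => y; apply/funext => v; rewrite mv_wedge_fun.
have msec : forall Z y, is_alternating 1 (mv_sec Z y).
  move=> Z y; split=> [v v' vv'|i v b u u' i1|i j v]; rewrite /mv_sec ?vv' //.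
    by case: i i1 => // _; rewrite /upd /= /pairing linearD linearZ /= mulmxDl -scalemxAl !mxE.
  by case: j => [|j]; rewrite ?ltnS ltn0 ?andbF.
rewrite (schouten_sec_fun S) // (schouten_sec_sec S) //.
rewrite -[(1 + 0).-1]/0%N -[(1 + 1).-1]/1%N !fE //; try exact: msec.
rewrite (_ : (fun y v => _) = mv_sec (fun y => f y *: Y y)); last first.
  by apply/funext => y; apply/funext => v; rewrite /mv_sec pairingZr.
rewrite (schouten_sec_sec S) //; last exact: smooth_sectionZ.
move=> /(congr1 (fun F => F x (fun=> alpha))); rewrite /mv_sec => ->.
by rewrite expr0 mul1r pairingDr !pairingZr addrC.
Qed.

(** On functions both brackets act through the anchor of NX, so the difference is zero; on sections
    the terms [NX, Y] cancel. The Leibniz signs are trivial since the first argument has degree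
    1. *)
Lemma schouten_deform_derivation E L N sbN sb X :
  is_schouten E (deform L N) sbN -> is_schouten E L sb ->
  smooth_hom E E N -> smooth_section E X ->
  mv_derivation E
    (fun q Q x v => sbN 1%N q (mv_sec X) Q x v - sb 1%N q (mv_sec (hom_app N X)) Q x v)
    (fun Y x => bracket L X (hom_app N Y) x - N x *m bracket L X Y x).
Proof.
move=> SN S sN sX; have sNX := smooth_hom_app sN sX.
have mX := is_multivector_sec sX; have mNX := is_multivector_sec sNX.
split=> [f sf|Y sY|q s Q T mQ mT|q Q x mQ].
- rewrite (schouten_sec_fun SN) // (schouten_sec_fun S) //.
  apply/funext => x; apply/funext => v; rewrite /mv_fun /anchor_act.
  rewrite (_ : hom_app (anchor (deform L N)) X = hom_app (anchor L) (hom_app N X)) ?subrr //.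
  by apply/funext => y; rewrite /hom_app mulmxA.
- rewrite (schouten_sec_sec SN) // (schouten_sec_sec S) //.
  apply/funext => x; apply/funext => v.
  rewrite /mv_sec /=.
  move: (bracket L (hom_app N X) Y x) (bracket L X _ x) (N x *m _) => A B C.
  by rewrite -(addrA A) (pairingDr _ A) addrAC subrr add0r.
- rewrite (schouten_leibniz SN) // (schouten_leibniz S) // mv_wedgeBl mv_wedgeBr.
  apply/funext => x; apply/funext => v.
  rewrite -[(1 + q).-1]/q -[(1 + s).-1]/s exprM sqrrN expr1n expr1n !mul1r; ring.
have := alternatingB 1 ((schouten_multivector SN mX mQ).1 x)
  ((schouten_multivector S mNX mQ).1 x).
by under eq_fun do rewrite mulr1.
Qed.

Lemma modular_vector_field_diff E L phi P N nu mu X :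
  smooth_hom E E N -> (forall y, N y \in unitmx) ->
  is_multivector (dual_bundle E) r nu -> non_vanishing nu -> is_volume_form mu ->
  is_modular_vector_field E L phi P N nu mu X ->
  X = diff_fun (dual_algebroid E L phi P) (hfun N 1).
Proof.
move=> sN uN mnu nu0 [_ mu0] [xiN [xi [[_ [sbN SN HN]] [_ [sb S H]] ->]]].
set L' := dual_algebroid E L phi P; have sT := smooth_hom_tr sN.
have uT y : transpose N y \in unitmx by rewrite unitmx_tr.
apply/funext => x; apply: pairing_injl => u.
have [alpha salpha <-] := section_through (dual_bundle E) x u.
have sTalpha := smooth_hom_app sT salpha.
(* Tested on alpha, the term N xi becomes xi evaluated on N^* alpha. *)
rewrite /diff_fun pairing_trmx pairingBl -{1}[N x]trmxK pairing_trmx.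
rewrite -[RHS]/(lie_at x (anchor L' x *m alpha x) (hfun N 1)) -hfun_transpose.
have [a [chi c]] := cutoff_exists (dual_bundle E) x.
(* For k = 1 the power of N is the identity, leaving the plain trace by which the difference of
   brackets multiplies nu. *)
rewrite (lie_at_hfun 1 c (schouten_derivation x S salpha) sT uT) subrr mul1mx.
have d := schouten_deform_derivation SN S sT salpha.
(* Arguments at which nu and mu are nonzero at x allow this factor to be divided out at the end. *)
have [v nuv] := nu0 x; have [w muw] := mu0 x.
have /choice[W HW] : forall i, exists W, smooth_section (tangent_bundle (M := M)) W /\ W x = w i.
  by move=> i; have [W sW Wx] := section_through (tangent_bundle (M := M)) x (w i); exists W.
have muW : mu x (W^~ x) != 0.
  by rewrite (_ : W^~ x = w) //; apply/funext => i; exact: (HW i).2.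
have := mv_derivation_top v c d mnu.
have := HN _ salpha W (fun i => (HW i).1) x v.
have := H _ sTalpha W (fun i => (HW i).1) x v.
(* Both modular identities now contain the same Lie derivative of mu, which cancels in the
   difference. *)
rewrite (_ : hom_app (anchor (deform L' (transpose N))) alpha =
  hom_app (anchor L') (hom_app (transpose N) alpha)); last first.
  by apply/funext => y; rewrite /hom_app /= mulmxA.
rewrite /eval_form; set t := \tr _.
move=> e0 e1 e2.
apply: (mulIf (mulf_neq0 nuv muW)); rewrite mulrBl e1 [X in _ - X]e0 mulrA -e2; ring.
Qed.

End Hierarchy.

(** * Matrices of bivectors *)

Section InducedJacobi.
Context {R : realType} {m r : nat} {M : manifold R m}.

Lemma sharp_of_sharp (S : M -> 'M[R]_r) : sharp (of_sharp S) = S.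
Proof.
apply/funext => x; apply/matrixP => i j; rewrite mxE /of_sharp /args2 /=.
by rewrite /pairing trmx_delta -colE -rowE !mxE.
Qed.

Lemma sharp_induced_bivector (L : algebroid M r) (S : M -> 'M[R]_r) x :
  sharp (induced_bivector L (of_sharp S)) x = anchor L x *m S x *m (anchor L x)^T.
Proof.
apply/matrixP => i j; rewrite mxE /induced_bivector /of_sharp /args2 /=.
rewrite pairing_trmx /pairing trmx_delta !mulmxA -colE -!mulmxA -rowE.
by rewrite !mxE.
Qed.

(** The source of the minus sign in d_Q f = - Q^# (d f), as [diff_fun] uses the transpose of the
    anchor. *)
Lemma sharp_skew (E : vbundle M r) (P : M -> multivector R r) x :
  is_multivector E 2 P -> (sharp P x)^T = - sharp P x.
Proof.
move=> mP; apply/matrixP => i j; rewrite !mxE; have alt := mP.1 x.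
rewrite -(alternating_swap _ alt (i := 0) (j := 1)) //.
by case: alt => ext _ _; apply: ext => -[|[|]].
Qed.

End InducedJacobi.

(** * The hierarchies on A, on M and on TM x R *)

Theorem theorem21 (R : realType) (m r : nat) (M : manifold R m)
    (A : vbundle M r) (L : algebroid M r) (phi0 : M -> 'cV[R]_r)
    (P : M -> multivector R r) (N : M -> 'M[R]_r)
    (JN : is_jacobi_nijenhuis A L phi0 P N)
    (Nnondegenerate : forall x, N x \in unitmx)
    (nu : M -> multivector R r) (mu : M -> multivector R m)
    (nu_top : is_multivector (dual_bundle A) r nu) (nu_neq0 : non_vanishing nu)
    (mu_volume : is_volume_form mu)
    (X : M -> 'cV[R]_r)
    (X_modular : is_modular_vector_field A L phi0 P N nu mu X) :
  let NP (i : int) := mul_bivector (zpow N i) P in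
  let d (Q : M -> multivector R r) (f : M -> R) :=
    diff_fun (dual_algebroid A L phi0 Q) f in
  let h := hfun N in
  let XA (k : int) : M -> 'cV[R]_r := hom_app (zpow N (k - 1)) X in
  let XM (k : int) : M -> 'cV[R]_m := hom_app (anchor L) (XA k) in
  let E (i : int) : M -> 'cV[R]_m := induced_field L phi0 (NP i) in
  let NPM (i : int) := sharp (induced_bivector L (NP i)) in
  [/\ exists f, smooth_fun f /\ X = d (mul_bivector N P) f,
      (forall i, smooth_fun (h i)),
      (forall k, smooth_section A (XA k)) /\
      (forall i j, XA (i + j) = d (NP i) (h j) /\
                   XA (i + j) = d (NP j) (h i)),
      (forall k, smooth_section (tangent_bundle (M := M)) (XM k)) /\
      (forall i j, XM (i + j) = (fun x => - hom_app (NPM i) (de_rham (h j)) x) /\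
                   XM (i + j) = (fun x => - hom_app (NPM j) (de_rham (h i)) x)) &
      exists Y : int -> tmr_section (M := M),
        (forall k, smooth_tmr_section (Y k)) /\
        (forall i j, Y (i + j) = (XM (i + j), eval_form (de_rham (h j)) (E i)))].
Proof.
move=> NP d h XA XM E NPM; have uN := Nnondegenerate.
case: JN => LA [sphi _] [mP _] nij NPsharp _; have sN := nij.1.
have uNT y : (N y)^T \in unitmx by rewrite unitmx_tr.
have XE := modular_vector_field_diff sN uN nu_top nu_neq0 mu_volume X_modular.
(* Modular forms on A^* are sections of the double dual, which is identified with A. *)
have sX : smooth_section A X.
  have [xiN [xi [[sxiN _] [sxi _] ->]]] := X_modular.
  have sNxi := smooth_hom_app sN (smooth_section_dualK sxi).
  have H := smooth_sectionD (smooth_section_dualK sxiN)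
    (smooth_sectionZ (fun x => @smooth_fun_at_cst _ _ _ (- 1) x) sNxi).
  by under eq_fun do rewrite -scaleN1r.
have sh i : smooth_fun (h i) by exact: smooth_hfun sN uN.
have sXA k : smooth_section A (XA k) by exact: smooth_hom_app (smooth_hom_mxz _ sN uN) sX.
(* The relation N^* d h_k = d h_(k+1) is iterated upwards, and downwards by inverting N^*. *)
have dh x k l : mxz (N x)^T l *m diff_fun L (h k) x = diff_fun L (h (k + l)) x.
  elim/int_ind: l => [|n IH|n IH].
  - by rewrite addr0 mul1mx.
  - rewrite -[n.+1]addn1 PoszD mxzS // -mulmxA IH.
    by rewrite (nijenhuis_diff_hfun _ _ LA nij uN) addrA.
  rewrite -[n.+1]addn1 PoszD opprD mxzP // -mulmxA IH addrA.
  by rewrite -{1}(subrK 1 (k - n%:Z)) -(nijenhuis_diff_hfun _ _ LA nij uN) mulKmx.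
have PN x k : (sharp P x)^T *m mxz (N x)^T k = mxz (N x) k *m (sharp P x)^T.
  by apply: mxz_intertwine => //; rewrite -[in RHS](trmxK (N x)) -!trmx_mul NPsharp.
(* Since X = d_P h_1, moving N^(k-1) through P^# lets it act on d h_1 as a power of N^*, which gives
   d_P h_k. *)
have XAE k x : XA k x = (sharp P x)^T *m diff_fun L (h k) x.
  rewrite /XA /hom_app XE -[zpow N _ x]/(mxz (N x) (k - 1)) /diff_fun /= trmx_mul.
  by rewrite -mulmxA mulmxA -PN -mulmxA dh addrC subrK.
have dE i j : d (NP i) (h j) = XA (i + j).
  apply/funext => x; rewrite XAE /d /diff_fun /= /NP /mul_bivector sharp_of_sharp.
  rewrite -[zpow N i x]/(mxz (N x) i) !trmx_mul -mxz_tr -!mulmxA -/(diff_fun L (h j) x).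
  by rewrite dh [j + i]addrC.
have dE' i j : d (NP j) (h i) = XA (i + j) by rewrite dE addrC.
have sXM k : smooth_section (tangent_bundle (M := M)) (XM k).
  exact: smooth_hom_app (anchor_smooth LA) (sXA k).
have XME i j : XM (i + j) = (fun x => - hom_app (NPM i) (de_rham (h j)) x).
  apply/funext => x; rewrite /XM -dE /hom_app /NPM /NP /mul_bivector sharp_induced_bivector.
  rewrite /d /diff_fun /= sharp_of_sharp -[zpow N i x]/(mxz (N x) i).
  rewrite !trmx_mul -mxz_tr PN (sharp_skew x mP) !(mulmxN, mulNmx).
  by rewrite -!mulmxA.
split=> //.
(* X has index 1 = 1 + 0, so its potential for N^1 P is h_0. *)
- exists (h 0); split => //; rewrite -[mul_bivector N P]/(NP 1) dE /XA addr0 subrr.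
  by apply/funext => x; rewrite /hom_app /= mul1mx.
- by split=> // i j; split; [|rewrite addrC].
(* The pairing of d h_j with E_M^i equals that of phi_0 with d_{N^i P} h_j, which depends on i + j
   only. *)
exists (fun k => (XM k, eval_form phi0 (XA k))); split=> [k|i j].
  by split; [exact: sXM|exact: (smooth_eval_form sphi (sXA k))].
congr pair; apply/funext => x; rewrite -dE /eval_form /E.
by rewrite pairingC /d /diff_fun pairing_trmx /induced_field /hom_app mulmxA.
Qed.
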